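(* Let $\gamma>1$, $0<r_0<r_1$, and let an incoming flow at $r=r_0$ be given by $\rho_0>0$, $A_0>0$, $U_{10}>0$, $U_{20}\neq0$ which is supersonic in the $r$-direction, i.e. $U_{10}^2>\gamma A_0\rho_0^{\gamma-1}$. Then there exist two constants $p_1<p_0$ such that for any $p_{ex}\in(p_1,p_0)$ there exists a unique piecewise smooth solution to Problem III in $\Omega$ with a shock located at $r\equiv r_b$ and satisfying $U_1^-(r)>c^-(r)$ for $r\in(r_0,r_b)$ and $U_1^+(r)<c^+(r)$ for $r\in(r_b,r_1)$. Furthermore: (A) The shock position $r_b$ increases as the exit pressure $p_{ex}$ decreases. In addition, $r_b$ tends to $r_1$ if $p_{ex}$ goes to $p_1$, while $r_b$ approaches $r_0$ if $p_{ex}$ goes to $p_0$. (B) The flow patterns in $\Omega^+$ are classified as follows. 1. If $r_0<r_1\le r'_*$ and $p_{ex}\in(p_1,p_0)$, then 1.1. for $f_2(\rho^\sharp)>0$, there exists a supersonic-supersonic shock and the flow is supersonic in $\Omega^+$; 1.2. for $f_2(\rho^\sharp)<0$, there exists a supersonic-supersonic shock and the flow changes smoothly from supersonic to subsonic in $\Omega^+$; 1.3. for $f_2(\rho^\sharp)=0$, there exists a supersonic-supersonic shock and the flow is supersonic in $\Omega^+$ but degenerates to a sonic state at the exit. 2. If $r_0<r'_*<r_1$, then there exists $p'_*\in(p_1,p_0)$ such that 2.1. for $p_{ex}\in(p'_*,p_0)$ with $f_2(\rho^\sharp)>0$, a supersonic-supersonic shock exists and the flow is supersonic in $\Omega^+$;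 2.2. for $p_{ex}\in(p'_*,p_0)$ with $f_2(\rho^\sharp)<0$, a supersonic-supersonic shock exists and the flow changes smoothly from supersonic to subsonic in $\Omega^+$; 2.3. for $p_{ex}\in(p'_*,p_0)$ with $f_2(\rho^\sharp)=0$, a supersonic-supersonic shock exists and the flow is supersonic in $\Omega^+$ but degenerates to a sonic state at the exit; 2.4. for $p_{ex}\in(p_1,p'_* )$, a supersonic-subsonic shock exists and the flow is subsonic in $\Omega^+$; 2.5. for $p_{ex}=p'_*$, there exists a supersonic-sonic shock and the flow is subsonic in $\Omega^+$ but degenerates to a sonic state at the shock position. 3. If $r_1>r_0\ge r'_*$, then for any $p_{ex}\in(p_1,p_0)$ there exists a supersonic-subsonic shock and the flow is uniformly subsonic in $\Omega^+$.
   Context: Radially symmetric steady Euler system (for velocity $U_1(r)\mathbf e_r+U_2(r)\mathbf e_\theta$, density $\rho>0$, pressure $p=A\rho^\gamma$ with $A>0$): $$(E)\quad(\rho U_1)'+\tfrac1r\rho U_1=0,\quad U_1U_1'+\tfrac1\rho p'-\tfrac{U_2^2}{r}=0,\quad U_1U_2'+\tfrac{U_1U_2}{r}=0,\quad U_1A'=0.$$ Sound speed $c^2=\gamma p/\rho$; Bernoulli function $B=\frac12(U_1^2+U_2^2)+\frac{\gamma p}{(\gamma-1)\rho}$. The flow is supersonic, sonic, subsonic where $U_1^2+U_2^2>c^2$, $=c^2$, $<c^2$ respectively. Problem III. On $\Omega=\{r_0<r<r_1\}$ find $r_b\in(r_0,r_1)$ and smooth functions $(U_1^\pm,U_2^\pm,\rho^\pm,p^\pm,A^\pm)$,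 where the ''$-$'' state is defined on $\Omega^-=\{r_0<r<r_b\}$ and the ''$+$'' state on $\Omega^+=\{r_b<r<r_1\}$ (continuous up to the closures), solving (E) in $\Omega^\pm$, satisfying at $r=r_b$ the Rankine-Hugoniot conditions $[\rho U_1]=[\rho U_1^2+p]=[\rho U_1U_2]=[B]=0$ and the entropy condition $[p]>0$, where $[v]=v^+(r_b)-v^-(r_b)$, and the boundary conditions $\rho(r_0)=\rho_0$, $U_1(r_0)=U_{10}$, $U_2(r_0)=U_{20}$, $A(r_0)=A_0$, $p(r_1)=p_{ex}$. Superscripts $\pm$ on $c$ refer to these states. The shock is called supersonic-supersonic, supersonic-sonic or supersonic-subsonic if the state ahead of it (the ''$-$'' state) is supersonic and the state just behind it (the ''$+$'' state at $r=r_b$) is supersonic, sonic or subsonic respectively. The exit is $r=r_1$. Constants and functions: $\kappa_1=r_0\rho_0U_{10}$, $\kappa_2=r_0U_{20}$, $B_0=\frac12(U_{10}^2+U_{20}^2)+\frac{\gamma A_0}{\gamma-1}\rho_0^{\gamma-1}$, $$f_1(r)=\left(1-\frac{(U_2^-)^2}{\frac{2(\gamma-1)}{\gamma+1}B_0-\frac{\gamma-1}{\gamma+1}(U_2^-)^2}\right)\frac{(U_1^-)^2}{(c^-)^2},$$ where here $(U_1^-,U_2^-,\rho^-,A^-)$ is the smooth solution of (E) with the given data at $r=r_0$, extended to its maximal interval of existence (which contains $[r_0,\infty)$); $$f_2(\rho)=\frac{\gamma p_{ex}}{\gamma-1}\rho-\left(B_0-\frac{\kappa_2^2}{2r_1^2}\right)\rho^2+\frac{\kappa_1^2}{2r_1^2},\qquad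 \rho^\sharp=\frac{\gamma(\gamma+1)p_{ex}}{2(\gamma-1)B_0},\qquad r_*=\sqrt{\frac{\gamma\kappa_2^2}{(\gamma-1)B_0}}.$$ $f_1$ is increasing for $r>r_*$, and $r'_*$ denotes the unique $r>r_*$ with $f_1(r)=1$; it is determined by the incoming flow and (E). *)

(* Defs.v *)
From Stdlib Require Export Reals.
From Coquelicot Require Export Coquelicot.
Open Scope R_scope.

(** Radial profiles of the flow U1 e_r + U2 e_theta.  The fields are total
    functions; only their values on the interval under consideration matter.
    The pressure is derived from A and rho. *)
Record flow := Flow {
  U1 : R -> R;
  U2 : R -> R;
  rho : R -> R;
  A : R -> R
}.

Definition pressure (g : R) (F : flow) (r : R) : R :=
  A F r * Rpower (rho F r) g.

Definition sound (g : R) (F : flow) (r : R) : R :=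
  sqrt (g * pressure g F r / rho F r).

Definition bernoulli (g : R) (F : flow) (r : R) : R :=
  / 2 * (U1 F r ^ 2 + U2 F r ^ 2)
  + g * pressure g F r / ((g - 1) * rho F r).

Definition supersonic (g : R) (F : flow) (r : R) : Prop :=
  U1 F r ^ 2 + U2 F r ^ 2 > sound g F r ^ 2.

Definition sonic (g : R) (F : flow) (r : R) : Prop :=
  U1 F r ^ 2 + U2 F r ^ 2 = sound g F r ^ 2.

Definition subsonic (g : R) (F : flow) (r : R) : Prop :=
  U1 F r ^ 2 + U2 F r ^ 2 < sound g F r ^ 2.

(** C^infinity on D, for D open. *)
Definition smooth_on (D : R -> Prop) (f : R -> R) : Prop :=
  forall (n : nat) (x : R), D x -> ex_derive_n f n x.

Definition euler (g : R) (F : flow) (r : R) : Prop :=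
  Derive (fun s => rho F s * U1 F s) r + / r * (rho F r * U1 F r) = 0
  /\ U1 F r * Derive (U1 F) r + / rho F r * Derive (pressure g F) r
     - U2 F r ^ 2 / r = 0
  /\ U1 F r * Derive (U2 F) r + U1 F r * U2 F r / r = 0
  /\ U1 F r * Derive (A F) r = 0.

Definition smooth_solution (g : R) (D : R -> Prop) (F : flow) : Prop :=
  smooth_on D (U1 F) /\ smooth_on D (U2 F)
  /\ smooth_on D (rho F) /\ smooth_on D (A F)
  /\ (forall r, D r -> 0 < rho F r /\ 0 < A F r /\ euler g F r).

(** Smooth solution on the open interval (a, b), continuous (with positive rho
    and A) on [a, b]; at the endpoints only one-sided limits are involved. *)
Definition solution_upto_closure (g a b : R) (F : flow) : Prop :=
  let cl := fun r => a <= r <= b in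
  smooth_solution g (fun r => a < r < b) F
  /\ continuous_on cl (U1 F) /\ continuous_on cl (U2 F)
  /\ continuous_on cl (rho F) /\ continuous_on cl (A F)
  /\ (forall r, cl r -> 0 < rho F r /\ 0 < A F r).

Record inflow := Inflow {
  rho0 : R;
  U10 : R;
  U20 : R;
  A0 : R
}.

Definition has_data (r0 : R) (I : inflow) (F : flow) : Prop :=
  rho F r0 = rho0 I /\ U1 F r0 = U10 I /\ U2 F r0 = U20 I /\ A F r0 = A0 I.

Definition rankine_hugoniot (g : R) (Fm Fp : flow) (rb : R) : Prop :=
  rho Fp rb * U1 Fp rb = rho Fm rb * U1 Fm rb
  /\ rho Fp rb * U1 Fp rb ^ 2 + pressure g Fp rb
     = rho Fm rb * U1 Fm rb ^ 2 + pressure g Fm rb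
  /\ rho Fp rb * U1 Fp rb * U2 Fp rb = rho Fm rb * U1 Fm rb * U2 Fm rb
  /\ bernoulli g Fp rb = bernoulli g Fm rb.

Definition problem_III (g r0 r1 : R) (I : inflow) (pex rb : R)
    (Fm Fp : flow) : Prop :=
  r0 < rb < r1
  /\ solution_upto_closure g r0 rb Fm
  /\ solution_upto_closure g rb r1 Fp
  /\ rankine_hugoniot g Fm Fp rb
  /\ pressure g Fp rb > pressure g Fm rb
  /\ has_data r0 I Fm
  /\ pressure g Fp r1 = pex.

Definition shock_solution (g r0 r1 : R) (I : inflow) (pex rb : R)
    (Fm Fp : flow) : Prop :=
  problem_III g r0 r1 I pex rb Fm Fp
  /\ (forall r, r0 < r < rb -> U1 Fm r > sound g Fm r)
  /\ (forall r, rb < r < r1 -> U1 Fp r < sound g Fp r).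

Definition flow_eq_on (a b : R) (F G : flow) : Prop :=
  forall r, a <= r <= b ->
    U1 F r = U1 G r /\ U2 F r = U2 G r /\ rho F r = rho G r /\ A F r = A G r.

Definition supersonic_supersonic_shock (g r0 rb : R) (Fm Fp : flow) : Prop :=
  (forall r, r0 <= r <= rb -> supersonic g Fm r) /\ supersonic g Fp rb.

Definition supersonic_sonic_shock (g r0 rb : R) (Fm Fp : flow) : Prop :=
  (forall r, r0 <= r <= rb -> supersonic g Fm r) /\ sonic g Fp rb.

Definition supersonic_subsonic_shock (g r0 rb : R) (Fm Fp : flow) : Prop :=
  (forall r, r0 <= r <= rb -> supersonic g Fm r) /\ subsonic g Fp rb.

(** Patterns of the flow behind the shock, on [rb, r1].  The endpoints are
    included wherever the flow does not degenerate there, so that the patterns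
    are mutually exclusive. *)
Definition supersonic_flow (g rb r1 : R) (F : flow) : Prop :=
  forall r, rb <= r <= r1 -> supersonic g F r.

Definition supersonic_to_subsonic_flow (g rb r1 : R) (F : flow) : Prop :=
  exists rs, rb < rs < r1
    /\ (forall r, rb <= r < rs -> supersonic g F r)
    /\ sonic g F rs
    /\ (forall r, rs < r <= r1 -> subsonic g F r).

Definition supersonic_flow_sonic_exit (g rb r1 : R) (F : flow) : Prop :=
  (forall r, rb <= r < r1 -> supersonic g F r) /\ sonic g F r1.

Definition subsonic_flow (g rb r1 : R) (F : flow) : Prop :=
  forall r, rb <= r <= r1 -> subsonic g F r.

Definition subsonic_flow_sonic_shock (g rb r1 : R) (F : flow) : Prop :=
  sonic g F rb /\ (forall r, rb < r <= r1 -> subsonic g F r).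

Definition uniformly_subsonic_flow (g rb r1 : R) (F : flow) : Prop :=
  exists eps, 0 < eps
    /\ forall r, rb <= r <= r1 ->
         U1 F r ^ 2 + U2 F r ^ 2 <= (1 - eps) * sound g F r ^ 2.

Definition kappa1 (r0 : R) (I : inflow) : R := r0 * rho0 I * U10 I.

Definition kappa2 (r0 : R) (I : inflow) : R := r0 * U20 I.

Definition B0 (g : R) (I : inflow) : R :=
  / 2 * (U10 I ^ 2 + U20 I ^ 2)
  + g * A0 I / (g - 1) * Rpower (rho0 I) (g - 1).

Definition f1 (g : R) (I : inflow) (F : flow) (r : R) : R :=
  (1 - U2 F r ^ 2 /
       (2 * (g - 1) / (g + 1) * B0 g I - (g - 1) / (g + 1) * U2 F r ^ 2))
  * (U1 F r ^ 2 / sound g F r ^ 2).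

Definition f2 (g r0 r1 : R) (I : inflow) (pex x : R) : R :=
  g * pex / (g - 1) * x
  - (B0 g I - kappa2 r0 I ^ 2 / (2 * r1 ^ 2)) * x ^ 2
  + kappa1 r0 I ^ 2 / (2 * r1 ^ 2).

Definition rho_sharp (g : R) (I : inflow) (pex : R) : R :=
  g * (g + 1) * pex / (2 * (g - 1) * B0 g I).

Definition r_star (g r0 : R) (I : inflow) : R :=
  sqrt (g * kappa2 r0 I ^ 2 / ((g - 1) * B0 g I)).

(** Solution of the initial value problem at r0 on (a, b), 0 <= a < r0 < b,
    with b possibly infinite. *)
Definition ivp_solution (g r0 : R) (I : inflow) (a : R) (b : Rbar)
    (F : flow) : Prop :=
  0 <= a < r0 /\ Rbar_lt r0 b
  /\ smooth_solution g (fun r => a < r /\ Rbar_lt r b) F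
  /\ has_data r0 I F.

Definition maximal_ivp_solution (g r0 : R) (I : inflow) (a : R) (b : Rbar)
    (F : flow) : Prop :=
  ivp_solution g r0 I a b F
  /\ forall (a' : R) (b' : Rbar) (G : flow),
       ivp_solution g r0 I a' b' G -> a <= a' /\ Rbar_le b' b.

(** [is_r_star' g r0 I s]: s > r_* is a solution of f_1(s) = 1, where f_1 is
    computed from the maximal smooth extension of the incoming flow; s may lie
    on either side of r0. *)
Definition is_r_star' (g r0 : R) (I : inflow) (s : R) : Prop :=
  exists (a : R) (b : Rbar) (F : flow),
    maximal_ivp_solution g r0 I a b F
    /\ a < s /\ Rbar_lt s b
    /\ r_star g r0 I < s
    /\ f1 g I F s = 1.

(* Main.v *)
Require Import Defs.
From Stdlib Require Import Reals Lra Psatz IndefiniteDescription.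
From Coquelicot Require Import Coquelicot.
Open Scope R_scope.

(** Along a solution of the radial Euler system the mass flux r rho U1, the
    angular momentum r U2, the entropy A and the Bernoulli function are
    constant, so that the flow is determined by algebra at each radius.  Put
    M = U1^2 / c^2 and E(r) = B - k2^2 / (2 r^2), where k1, k2, B denote the
    first, second and fourth constant.  Eliminating rho and U1 leaves the single
    equation
      ln M - (g+1)/(g-1) ln ((g-1) M + 2) = z(A, r),
    whose left side [mach_fn] increases on (0, 1], decreases on [1, oo) and tends
    to -oo at both ends, and whose right side [flow_level] decreases in r and
    increases in A.  Below the sonic level [mach_fn g 1] there are therefore
    exactly one state with M < 1 and one with M > 1, both smooth in z
    ([subsonic_branch_exists], [supersonic_branch_exists]).  Since z decreases in
    r, a flow which starts off M = 1 extends to all larger radii, and a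
    continuous solution cannot change branch ([solution_stays_on_branch]).

    A normal shock preserves k1, k2 and B.  By the Prandtl relation
    U1^- U1^+ = 2 (g-1)/(g+1) E it is determined by the state ahead, and it
    multiplies A by a factor which increases with M^- > 1
    ([entropy_jump_increasing]).  Ahead of the shock M^- increases with r, so the
    entropy behind increases with the shock radius.  At the exit a larger entropy
    raises z, hence the subsonic Mach number, hence lowers the pressure.  The exit
    pressure is thus a continuous strictly decreasing function of the shock radius
    ([exit_pressure_decreasing]); p1 and p0 are its values at r1 and r0, and its
    inverse is the shock position.  This yields existence, uniqueness and the
    monotonicity and limits of the shock position.

    For the patterns, constancy of B makes the flow supersonic, sonic or subsonic
    according to whether c^2 is smaller than, equal to or larger than
    K = 2 (g-1)/(g+1) B ([speed_regimes]).  Behind the shock c^2 increases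
    strictly with r ([behind_csq_increasing]), so only the signs of c^2 - K at the
    shock and at the exit matter.  At the exit, f2 vanishes at the exit density,
    which makes f2(rho_sharp) a positive multiple of K - c^2 ([f2_at_sharp]).  At
    the shock, c^2 - K is a positive multiple of f1 - 1 ([csq_at_shock]), and f1
    increases wherever it is positive, so the comparison of f1 with 1 is that of
    the shock radius with r'_* ([regime_at_shock]). *)

(** * Functions of class C^k and C^infinity on a set *)

(** The derivative is carried as a witness and the conditions are pointwise, so
    that sums, products and composites are treated by plain induction on n, on
    sets which need not be open. *)
Fixpoint Ck (n : nat) (D : R -> Prop) (f : R -> R) : Prop :=
  match n with
  | O => forall x, D x -> continuous f x
  | S k => exists f', (forall x, D x -> is_derive f x (f' x)) /\ Ck k D f'
  end.

Definition Cinf (D : R -> Prop) (f : R -> R) : Prop := forall n, Ck n D f.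

Lemma is_derive_continuous (f : R -> R) (x l : R) :
  is_derive f x l -> continuous f x.
Proof. intros H; apply (ex_derive_continuous (V := R_NormedModule)); now exists l. Qed.

Lemma Ck_pred n D f : Ck (S n) D f -> Ck n D f.
Proof.
  revert f; induction n as [|n IH]; intros f [f' [H1 H2]].
  - intros x Hx; eapply is_derive_continuous, H1, Hx.
  - exists f'; split; [exact H1|]. now apply IH.
Qed.

Lemma Ck_sub n (D D' : R -> Prop) f :
  (forall x, D' x -> D x) -> Ck n D f -> Ck n D' f.
Proof.
  intros HD; revert f; induction n as [|n IH]; intros f; simpl.
  - intros H x Hx; apply H, HD, Hx.
  - intros [f' [H1 H2]]; exists f'; split; auto.
Qed.

Lemma Cinf_continuous D f x : Cinf D f -> D x -> continuous f x.
Proof. intros H Hx; exact (H 0%nat x Hx). Qed.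

Lemma Cinf_const D c : Cinf D (fun _ => c).
Proof.
  intros n; revert c; induction n as [|n IH]; intros c; simpl.
  - intros x _; apply continuous_const.
  - exists (fun _ => 0); split; [|apply IH].
    intros x _; apply (is_derive_const (V := R_NormedModule)).
Qed.

Lemma Cinf_id D : Cinf D (fun x => x).
Proof.
  intros [|n]; simpl.
  - intros x _; apply continuous_id.
  - exists (fun _ => 1); split; [|apply Cinf_const].
    intros x _; apply (is_derive_id (K := R_AbsRing)).
Qed.

Lemma Ck_plus n D f h : Ck n D f -> Ck n D h -> Ck n D (fun x => f x + h x).
Proof.
  revert f h; induction n as [|n IH]; intros f h; simpl.
  - intros Hf Hh x Hx; apply (continuous_plus (V := R_NormedModule)); auto.
  - intros [f' [F1 F2]] [h' [H1 H2]]; exists (fun x => f' x + h' x); split; auto.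
    intros x Hx; apply (is_derive_plus (V := R_NormedModule)); auto.
Qed.

Lemma Ck_mult n D f h : Ck n D f -> Ck n D h -> Ck n D (fun x => f x * h x).
Proof.
  revert f h; induction n as [|n IH]; intros f h.
  - intros Hf Hh x Hx; apply (continuous_mult (K := R_AbsRing)); auto.
  - intros Hf Hh; assert (Gf := Ck_pred _ _ _ Hf); assert (Gh := Ck_pred _ _ _ Hh).
    destruct Hf as [f' [F1 F2]]; destruct Hh as [h' [H1 H2]].
    exists (fun x => f' x * h x + f x * h' x); split.
    + intros x Hx; apply (is_derive_mult (K := R_AbsRing)); auto.
      intros; apply Rmult_comm.
    + apply Ck_plus; apply IH; auto.
Qed.

Lemma Ck_comp n (D E : R -> Prop) f h :
  (forall x, D x -> E (h x)) -> Ck n E f -> Ck n D h -> Ck n D (fun x => f (h x)).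
Proof.
  intros HD; revert f h HD; induction n as [|n IH]; intros f h HD.
  - intros Hf Hh x Hx; apply continuous_comp; [now apply Hh | apply Hf; auto].
  - intros Hf Hh; assert (Gh := Ck_pred _ _ _ Hh).
    destruct Hf as [f' [F1 F2]]; destruct Hh as [h' [H1 H2]].
    exists (fun x => h' x * f' (h x)); split.
    + intros x Hx; apply (is_derive_comp (V := R_NormedModule)); auto.
    + apply Ck_mult; auto.
Qed.

Lemma Cinf_plus D f h : Cinf D f -> Cinf D h -> Cinf D (fun x => f x + h x).
Proof. intros H1 H2 n; apply Ck_plus; auto. Qed.

Lemma Cinf_mult D f h : Cinf D f -> Cinf D h -> Cinf D (fun x => f x * h x).
Proof. intros H1 H2 n; apply Ck_mult; auto. Qed.

Lemma Cinf_comp (D E : R -> Prop) f h :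
  (forall x, D x -> E (h x)) -> Cinf E f -> Cinf D h -> Cinf D (fun x => f (h x)).
Proof. intros HD H1 H2 n; now apply (Ck_comp n D E). Qed.

Lemma Cinf_opp D f : Cinf D f -> Cinf D (fun x => - f x).
Proof.
  intros H; apply (Cinf_comp D (fun _ => True) (fun y => - y) f); auto.
  intros [|n]; simpl.
  - intros x _; apply (continuous_opp (V := R_NormedModule)), continuous_id.
  - exists (fun _ => -1); split; [|apply Cinf_const].
    intros x _; auto_derive; [exact I | ring].
Qed.

Lemma Cinf_minus D f h : Cinf D f -> Cinf D h -> Cinf D (fun x => f x - h x).
Proof. intros H1 H2; apply Cinf_plus; [|apply Cinf_opp]; auto. Qed.

(** A solution of f' = k(f) is as smooth as k, because k(f) inherits every
    order of differentiability already known for f.  This gives the smoothness of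
    inverse functions from their first derivative alone. *)
Lemma Cinf_autonomous (D E : R -> Prop) k f :
  Cinf E k -> (forall x, D x -> E (f x)) ->
  (forall x, D x -> is_derive f x (k (f x))) -> Cinf D f.
Proof.
  intros Hk HE Hd; intros n; induction n as [|n IH].
  - intros x Hx; eapply is_derive_continuous; eauto.
  - exists (fun x => k (f x)); split; auto.
    now apply (Ck_comp n D E).
Qed.

Lemma Cinf_exp D f : Cinf D f -> Cinf D (fun x => exp (f x)).
Proof.
  apply (Cinf_comp D (fun _ => True)); auto.
  apply (Cinf_autonomous _ (fun _ => True) (fun y => y)); auto using Cinf_id.
  intros x _; apply is_derive_exp.
Qed.

Lemma Cinf_inv (D : R -> Prop) f :
  (forall x, D x -> f x <> 0) -> Cinf D f -> Cinf D (fun x => / f x).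
Proof.
  intros H0; apply (Cinf_comp D (fun x => x <> 0)); auto.
  apply (Cinf_autonomous _ (fun _ => True) (fun y => - (y * y))); auto.
  - apply Cinf_opp, Cinf_mult; apply Cinf_id.
  - intros x Hx; auto_derive; auto. field; auto.
Qed.

Lemma Cinf_div (D : R -> Prop) f h :
  (forall x, D x -> h x <> 0) -> Cinf D f -> Cinf D h ->
  Cinf D (fun x => f x / h x).
Proof. intros; apply Cinf_mult, Cinf_inv; auto. Qed.

Lemma Cinf_ln (D : R -> Prop) f :
  (forall x, D x -> 0 < f x) -> Cinf D f -> Cinf D (fun x => ln (f x)).
Proof.
  intros H0; apply (Cinf_comp D (fun x => 0 < x)); auto.
  intros [|n].
  - intros x Hx; now apply continuous_ln.
  - exists (fun x => / x); split; [intros x Hx; now apply is_derive_ln|].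
    apply (Cinf_inv _ (fun x => x)); [intros; lra | apply Cinf_id].
Qed.

(** Openness of D lets the witness of the derivative be replaced by the
    derivative itself in a neighbourhood. *)
Lemma Cinf_smooth_on (D : R -> Prop) f : open D -> Cinf D f -> smooth_on D f.
Proof.
  intros HD Hf n; specialize (Hf n); revert f Hf.
  induction n as [|n IH]; intros f Hf x Hx; [exact I|].
  destruct Hf as [f' [F1 F2]]. destruct n as [|n]; [exists (f' x); auto|].
  specialize (IH f' F2 x Hx); simpl in IH |- *.
  apply (ex_derive_ext_loc (Derive_n f' n)); [|exact IH].
  generalize (HD x Hx); apply filter_imp; intros y Hy.
  change (Derive (Derive_n f n) y) with (Derive_n f (S n) y).
  replace (S n) with (n + 1)%nat by lia; rewrite <- Derive_n_comp.
  apply Derive_n_ext_loc; generalize (HD y Hy); apply filter_imp; intros t Ht.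
  symmetry; now apply is_derive_unique, F1.
Qed.

(** * Inverse functions *)

(** Write q for the difference quotient of f at h(z), taken towards h(w);
    that of h is 1 / q, and q tends to d by continuity of h. *)
Lemma is_derive_inverse (f h : R -> R) (z d : R) :
  is_derive f (h z) d -> d <> 0 -> continuous h z ->
  locally z (fun w => f (h w) = w) -> is_derive h z (/ d).
Proof.
  intros Hf Hd Hh Hfh.
  apply is_derive_Reals; apply is_derive_Reals in Hf.
  assert (Hz : f (h z) = z) by apply (locally_singleton _ _ Hfh).
  intros eps Heps.
  (* The first bound keeps the difference quotient q of f away from 0, namely
     |q| > |d| / 2; the second makes |1/q - 1/d| = |q - d| / (|q| |d|) small. *)
  set (m := Rmin (Rabs d / 2) (eps * (d * d) / 4)).
  assert (Had : 0 < Rabs d) by now apply Rabs_pos_lt.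
  assert (Hdd : 0 < d * d) by nra.
  assert (Hm : 0 < m) by (apply Rmin_case; [lra | nra]).
  destruct (Hf m Hm) as [dl Hdl].
  assert (Hc : locally z (fun w => ball (h z) dl (h w))).
  { apply Hh; apply locally_ball. }
  destruct (filter_and _ _ Hc Hfh) as [e He].
  exists e; intros t Ht0 Ht.
  destruct (He (z + t)) as [B1 B2].
  { change (Rabs (z + t - z) < e); now replace (z + t - z) with t by ring. }
  change (Rabs (h (z + t) - h z) < dl) in B1.
  set (s := h (z + t) - h z) in *.
  assert (Hs : s <> 0).
  { intros Hs; assert (h (z + t) = h z) by (unfold s in Hs; lra).
    rewrite H in B2; lra. }
  specialize (Hdl s Hs B1).
  replace (h z + s) with (h (z + t)) in Hdl by (unfold s; ring).
  rewrite B2, Hz in Hdl; replace (z + t - z) with t in Hdl by ring.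
  assert (m1 : m <= Rabs d / 2) by apply Rmin_l.
  assert (m2 : m <= eps * (d * d) / 4) by apply Rmin_r.
  clearbody m; set (q := t / s) in *.
  assert (Hq : Rabs d / 2 < Rabs q).
  { generalize (Rabs_triang_inv d q); rewrite (Rabs_minus_sym d q); lra. }
  assert (Hq0 : q <> 0) by (intros E; rewrite E, Rabs_R0 in Hq; lra).
  replace (s / t - / d) with ((d - q) / (q * d)) by (unfold q; field; auto).
  unfold Rdiv; rewrite Rabs_mult, Rabs_inv, Rabs_mult.
  rewrite Rabs_minus_sym.
  assert (Hpos : 0 < Rabs q * Rabs d) by (apply Rmult_lt_0_compat; lra).
  apply (Rmult_lt_reg_r (Rabs q * Rabs d)); auto.
  rewrite Rmult_assoc, Rinv_l by lra; rewrite Rmult_1_r.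
  assert (E : d * d = Rabs d * Rabs d).
  { rewrite <- Rabs_mult; symmetry; apply Rabs_pos_eq; lra. }
  assert (Rabs d * Rabs d / 2 < Rabs q * Rabs d) by nra.
  rewrite E in m2. nra.
Qed.

(** By monotonicity alone: z lies strictly between the values of f at two points
    of the interval on either side of h(z) and within eps of it, and h(w) stays
    between these points as long as w stays between those values. *)
Lemma continuous_increasing_inverse (f h : R -> R) (a b : Rbar) (D : R -> Prop)
  (z : R) :
  (forall x y : R, Rbar_lt a x -> x < y -> Rbar_lt y b -> f x < f y) ->
  (forall w, D w -> Rbar_lt a (h w) /\ Rbar_lt (h w) b /\ f (h w) = w) ->
  open D -> D z -> continuous h z.
Proof.
  intros Hf Hh HD Hz; apply filterlim_locally; intros eps.
  destruct (Hh z Hz) as [Ha [Hb Hfz]].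
  assert (exists lo : R, Rbar_lt a lo /\ lo < h z /\ h z - eps <= lo) as [lo [L1 [L2 L3]]].
  { destruct a as [a| |]; simpl in *; try tauto.
    - exists (Rmax ((a + h z) / 2) (h z - eps / 2)).
      pose proof (cond_pos eps).
      unfold Rmax; destruct Rle_dec; lra.
    - exists (h z - eps / 2); pose proof (cond_pos eps); lra. }
  assert (exists hi : R, Rbar_lt hi b /\ h z < hi /\ hi <= h z + eps) as [hi [M1 [M2 M3]]].
  { destruct b as [b| |]; simpl in *; try tauto.
    - exists (Rmin ((b + h z) / 2) (h z + eps / 2)).
      pose proof (cond_pos eps).
      unfold Rmin; destruct Rle_dec; lra.
    - exists (h z + eps / 2); pose proof (cond_pos eps); lra. }
  assert (F1 : f lo < z) by (rewrite <- Hfz at 1; apply Hf; auto).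
  assert (F2 : z < f hi) by (rewrite <- Hfz at 1; apply Hf; auto).
  assert (O : locally z (fun w => f lo < w < f hi)).
  { apply (open_and _ _ (open_gt (f lo)) (open_lt (f hi))); auto. }
  generalize (filter_and _ _ O (HD z Hz)); apply filter_imp.
  intros w [Hw Dw]; destruct (Hh w Dw) as [Wa [Wb Wf]].
  change (Rabs (h w - h z) < eps); apply Rabs_def1.
  - destruct (Rlt_le_dec (h w) hi); [lra|].
    exfalso; destruct (Req_dec hi (h w)) as [E|E]; [rewrite E in Hw; lra|].
    assert (f hi < f (h w)); [|lra].
    apply Hf; auto; [|lra]. apply (Rbar_lt_trans _ (h z)); auto.
  - destruct (Rlt_le_dec lo (h w)); [lra|].
    exfalso; destruct (Req_dec lo (h w)) as [E|E]; [rewrite E in Hw; lra|].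
    assert (f (h w) < f lo); [|lra].
    apply Hf; auto; [lra|]. apply (Rbar_lt_trans _ (h z)); auto.
Qed.

(** * Functions continuous on a closed interval *)

Lemma locally_interval (a b r : R) : a < r < b -> locally r (fun s => a < s < b).
Proof. intros H; apply (open_and _ _ (open_gt a) (open_lt b)); auto. Qed.

Lemma open_interval (a b : R) : open (fun r => a < r < b).
Proof. apply (open_and _ _ (open_gt a) (open_lt b)). Qed.

Lemma continuous_Rmult (f h : R -> R) (x : R) :
  continuous f x -> continuous h x -> continuous (fun y => f y * h y) x.
Proof. exact (continuous_mult (K := R_AbsRing) f h x). Qed.

Lemma continuous_Rpower_l (f : R -> R) (e x : R) :
  continuous f x -> 0 < f x -> continuous (fun y => Rpower (f y) e) x.
Proof.
  intros Hf H0; unfold Rpower; apply continuous_exp_comp.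
  apply continuous_Rmult; [apply continuous_const|].
  apply continuous_comp; auto. now apply continuous_ln.
Qed.

Lemma continuous_sq (f : R -> R) (x : R) :
  continuous f x -> continuous (fun y => f y ^ 2) x.
Proof.
  intros Hf; apply (continuous_ext (fun y => f y * f y)); [intros y; change (f y * f y = f y ^ 2); ring|].
  now apply continuous_Rmult.
Qed.

(** Composing with the retraction of the line onto [a, b] turns one-sided
    continuity at the endpoints into continuity everywhere, as the mean value and
    intermediate value theorems require. *)
Definition clamp (a b x : R) : R := Rmax a (Rmin x b).

Lemma clamp_in a b x : a <= b -> a <= clamp a b x <= b.
Proof. unfold clamp, Rmax, Rmin; intros; repeat destruct Rle_dec; lra. Qed.

Lemma clamp_id a b x : a <= x <= b -> clamp a b x = x.
Proof. unfold clamp, Rmax, Rmin; intros; repeat destruct Rle_dec; lra. Qed.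

Lemma continuous_clamp_comp (a b : R) (f : R -> R) (x : R) :
  a <= b -> continuous_on (fun r => a <= r <= b) f ->
  continuous (fun y => f (clamp a b y)) x.
Proof.
  intros Hab Hf.
  specialize (Hf (clamp a b x) (clamp_in a b x Hab)).
  intros P HP; specialize (Hf P HP).
  destruct Hf as [e He]; exists e; intros y Hy; apply He; [|now apply clamp_in].
  change (Rabs (y - x) < e) in Hy; change (Rabs (clamp a b y - clamp a b x) < e).
  eapply Rle_lt_trans; [|exact Hy].
  unfold clamp, Rmax, Rmin; repeat destruct Rle_dec; unfold Rabs; repeat destruct Rcase_abs; lra.
Qed.

Lemma continuous_on_of_continuous (D : R -> Prop) (f : R -> R) :
  (forall x, D x -> continuous f x) -> continuous_on D f.
Proof. intros H; apply continuous_on_forall; auto. Qed.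

Lemma zero_derivative_constant (f : R -> R) (a b : R) :
  a < b -> (forall x, continuous (fun y => f (clamp a b y)) x) ->
  (forall x, a < x < b -> is_derive f x 0) ->
  forall x, a <= x <= b -> f x = f a.
Proof.
  intros Hab Hc Hd x Hx.
  destruct (MVT_gen (fun y => f (clamp a b y)) a x (fun _ => 0)) as [c [_ Hc2]].
  - intros y Hy; rewrite Rmin_left, Rmax_right in Hy by lra.
    apply (is_derive_ext_loc f); [|apply Hd; lra].
    assert (O : locally y (fun w => a < w < b)).
    { apply (open_and _ _ (open_gt a) (open_lt b)); lra. }
    generalize O; apply filter_imp; intros t Ht; rewrite clamp_id; auto; lra.
  - intros y _; apply continuity_pt_filterlim, Hc.
  - rewrite !clamp_id in Hc2 by lra; lra.
Qed.

Lemma avoided_value_same_side (f : R -> R) (a b v : R) :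
  a <= b -> (forall x, continuous (fun y => f (clamp a b y)) x) ->
  (forall x, a <= x <= b -> f x <> v) ->
  forall x y, a <= x <= b -> a <= y <= b -> f x < v -> f y < v.
Proof.
  intros Hab Hc Hv x y Hx Hy Hxv.
  destruct (Rlt_le_dec (f y) v) as [|Hyv]; auto; exfalso.
  destruct (IVT_gen_consistent (fun y => f (clamp a b y)) x y v Hc) as [c [Hc1 Hc2]].
  - rewrite !clamp_id by lra; unfold Rmin, Rmax; repeat destruct Rle_dec; lra.
  - apply (Hv (clamp a b c)); auto. now apply clamp_in.
Qed.

Lemma increasing_of_derivative (f f' : R -> R) (a b : R) :
  a < b -> (forall x, a <= x <= b -> is_derive f x (f' x)) ->
  (forall x, a < x < b -> 0 < f' x) -> f a < f b.
Proof.
  intros Hab Hd Hp.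
  destruct (MVT_cor2 f f' a b Hab) as [c [E Hc]].
  - intros c Hc; apply is_derive_Reals; auto.
  - assert (0 < f' c * (b - a)); [|lra].
    apply Rmult_lt_0_compat; [auto | lra].
Qed.

(** Existence of h is the intermediate value theorem.  Since h decreases and
    takes values in (a, b) only, the limits at the ends come from comparing p with
    the value of f at a point close to a or to b. *)
Lemma decreasing_inverse (f : R -> R) (a b : R) :
  a < b -> (forall x, a <= x <= b -> continuous f x) ->
  (forall x y, a <= x -> x < y -> y <= b -> f y < f x) ->
  exists h : R -> R,
    (forall p, f b < p < f a -> a < h p < b /\ f (h p) = p)
    /\ (forall p q, f b < p -> p < q -> q < f a -> h q < h p)
    /\ filterlim h (at_right (f b)) (locally b)
    /\ filterlim h (at_left (f a)) (locally a).
Proof.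
  intros Hab Hc Hf.
  assert (Ex : forall p, exists x, f b < p < f a -> a < x < b /\ f x = p).
  { intros p; destruct (Rlt_le_dec (f b) p) as [H1|H1]; [|exists 0; lra].
    destruct (Rlt_le_dec p (f a)) as [H2|H2]; [|exists 0; lra].
    destruct (IVT_gen_consistent (fun t => f (clamp a b t)) b a p) as [c [_ E]].
    - intros t; apply continuous_clamp_comp; [lra|].
      now apply continuous_on_of_continuous.
    - rewrite !clamp_id by lra; unfold Rmin, Rmax; repeat destruct Rle_dec; lra.
    - exists (clamp a b c); intros _; split; auto.
      destruct (clamp_in a b c (Rlt_le _ _ Hab)) as [[C1|C1] [C2|C2]]; try lra;
        exfalso; [rewrite C2 in E | rewrite <- C1 in E]; lra. }
  destruct (functional_choice _ Ex) as [h Hh].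
  exists h; split; auto; split; [|split].
  - intros p q H1 H2 H3.
    destruct (Hh p) as [P1 P2]; [lra|]; destruct (Hh q) as [Q1 Q2]; [lra|].
    destruct (Rlt_le_dec (h q) (h p)) as [|[L|L]]; auto; exfalso.
    + generalize (Hf (h p) (h q)); lra.
    + rewrite L in P2; lra.
  - apply filterlim_locally; intros eps.
    set (c := Rmax ((a + b) / 2) (b - eps / 2)).
    assert (Hc1 : a < c < b /\ b - eps < c).
    { pose proof (cond_pos eps); unfold c, Rmax; destruct Rle_dec; lra. }
    assert (Hfc : f b < f c) by (apply Hf; lra).
    assert (Hfc2 : f c < f a) by (apply Hf; lra).
    unfold at_right, within.
    generalize (open_lt (f c) (f b) Hfc); apply filter_imp; intros p P1 P2.
    destruct (Hh p) as [Q1 Q2]; [lra|].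
    change (Rabs (h p - b) < eps).
    assert (c < h p).
    { destruct (Rlt_le_dec c (h p)) as [|[L|L]]; auto; exfalso.
      - generalize (Hf (h p) c); lra.
      - rewrite L in Q2; lra. }
    apply Rabs_def1; lra.
  - apply filterlim_locally; intros eps.
    set (c := Rmin ((a + b) / 2) (a + eps / 2)).
    assert (Hc1 : a < c < b /\ c < a + eps).
    { pose proof (cond_pos eps); unfold c, Rmin; destruct Rle_dec; lra. }
    assert (Hfc : f b < f c) by (apply Hf; lra).
    assert (Hfc2 : f c < f a) by (apply Hf; lra).
    unfold at_left, within.
    generalize (open_gt (f c) (f a) Hfc2); apply filter_imp; intros p P1 P2.
    destruct (Hh p) as [Q1 Q2]; [lra|].
    change (Rabs (h p - a) < eps).
    assert (h p < c).
    { destruct (Rlt_le_dec (h p) c) as [|[L|L]]; auto; exfalso.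
      - generalize (Hf c (h p)); lra.
      - rewrite <- L in Q2; lra. }
    apply Rabs_def1; lra.
Qed.

(** * The equation for the radial Mach number *)

(** Logarithm of the squared mass flux as a function of M = u^2 / c^2, up to the
    terms in the energy and the entropy collected in [mach_level] below. *)
Definition mach_fn (g M : R) : R :=
  ln M - (g + 1) / (g - 1) * ln ((g - 1) * M + 2).

Lemma is_derive_mach_fn g M :
  1 < g -> 0 < M ->
  is_derive (mach_fn g) M (2 * (1 - M) / (M * ((g - 1) * M + 2))).
Proof.
  intros Hg HM; unfold mach_fn.
  assert (0 < (g - 1) * M + 2) by nra.
  auto_derive; [lra|]. field; lra.
Qed.

Lemma mach_fn_increasing g x y :
  1 < g -> 0 < x -> x < y -> y <= 1 -> mach_fn g x < mach_fn g y.
Proof.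
  intros Hg Hx Hxy Hy.
  apply (increasing_of_derivative _
    (fun M => 2 * (1 - M) / (M * ((g - 1) * M + 2)))); auto.
  - intros M HM; apply is_derive_mach_fn; lra.
  - intros M HM; apply Rdiv_lt_0_compat; [lra|].
    apply Rmult_lt_0_compat; nra.
Qed.

Lemma mach_fn_decreasing g x y :
  1 < g -> 1 <= x -> x < y -> mach_fn g y < mach_fn g x.
Proof.
  intros Hg Hx Hxy.
  apply Ropp_lt_cancel.
  apply (increasing_of_derivative (fun M => - mach_fn g M)
    (fun M => - (2 * (1 - M) / (M * ((g - 1) * M + 2))))); auto.
  - intros M HM; apply (is_derive_opp (V := R_NormedModule)).
    apply is_derive_mach_fn; lra.
  - intros M HM.
    replace (- (2 * (1 - M) / (M * ((g - 1) * M + 2))))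
      with (2 * (M - 1) / (M * ((g - 1) * M + 2))) by (field; nra).
    apply Rdiv_lt_0_compat; [lra|].
    apply Rmult_lt_0_compat; nra.
Qed.

Lemma mach_fn_lt_sonic g M :
  1 < g -> 0 < M -> M <> 1 -> mach_fn g M < mach_fn g 1.
Proof.
  intros Hg HM H1; destruct (Rlt_le_dec M 1).
  - apply mach_fn_increasing; lra.
  - apply mach_fn_decreasing; lra.
Qed.

Lemma mach_fn_inj g M N :
  1 < g -> 0 < M -> 0 < N -> 0 < (M - 1) * (N - 1) ->
  mach_fn g M = mach_fn g N -> M = N.
Proof.
  intros Hg HM HN Hs E.
  destruct (Rtotal_order M N) as [H|[H|H]]; auto; exfalso;
    (destruct (Rlt_le_dec M 1);
     [ assert (N < 1) by nra | assert (1 < M) by nra; assert (1 < N) by nra ]).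
  - generalize (mach_fn_increasing g M N); lra.
  - generalize (mach_fn_decreasing g M N); lra.
  - generalize (mach_fn_increasing g N M); lra.
  - generalize (mach_fn_decreasing g N M); lra.
Qed.

Lemma continuous_mach_fn g M : 1 < g -> 0 < M -> continuous (mach_fn g) M.
Proof. intros; eapply is_derive_continuous, is_derive_mach_fn; auto. Qed.

Lemma mach_fn_attains g x y z :
  1 < g -> 0 < x -> 0 < y -> mach_fn g x < z -> z < mach_fn g y ->
  exists M, Rmin x y < M < Rmax x y /\ mach_fn g M = z.
Proof.
  intros Hg Hx Hy H1 H2.
  set (lo := Rmin x y); set (hi := Rmax x y).
  assert (Hlo : 0 < lo) by (unfold lo; apply Rmin_case; auto).
  assert (Hlh : lo <= hi).
  { unfold lo, hi; apply (Rle_trans _ x); [apply Rmin_l | apply Rmax_l]. }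
  assert (Hxi : lo <= x <= hi) by (split; [apply Rmin_l | apply Rmax_l]).
  assert (Hyi : lo <= y <= hi) by (split; [apply Rmin_r | apply Rmax_r]).
  destruct (IVT_gen_consistent (fun t => mach_fn g (clamp lo hi t)) x y z) as [c [_ Hc]].
  - intros t; apply (continuous_clamp_comp lo hi); auto.
    apply continuous_on_of_continuous; intros u Hu; apply continuous_mach_fn; lra.
  - rewrite !clamp_id by auto; unfold Rmin, Rmax; repeat destruct Rle_dec; lra.
  - exists (clamp lo hi c); split; auto.
    assert (C := clamp_in lo hi c Hlh).
    assert (clamp lo hi c <> x) by (intros E; rewrite E in Hc; lra).
    assert (clamp lo hi c <> y) by (intros E; rewrite E in Hc; lra).
    unfold lo, hi, Rmin, Rmax in *; repeat destruct Rle_dec; lra.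
Qed.

(** Near 0 the term ln M dominates.  The bound is taken at most 1/2 in order to
    stay strictly below 1. *)
Lemma mach_fn_small g z : 1 < g -> exists x, 0 < x < 1 /\ mach_fn g x < z.
Proof.
  intros Hg; set (n := (g + 1) / (g - 1)).
  assert (Hn : 0 < n) by (apply Rdiv_lt_0_compat; lra).
  exists (Rmin (/ 2) (exp (z + n * ln 2))).
  set (x := Rmin _ _).
  assert (Hx : 0 < x) by (apply Rmin_case; [lra | apply exp_pos]).
  assert (Hx1 : x <= / 2) by apply Rmin_l.
  assert (Hx2 : ln x <= z + n * ln 2).
  { rewrite <- (ln_exp (z + n * ln 2)); apply ln_le; auto; apply Rmin_r. }
  split; [lra|]. unfold mach_fn; fold n.
  assert (ln 2 < ln ((g - 1) * x + 2)) by (apply ln_increasing; nra).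
  nra.
Qed.

(** The coefficient n of the second logarithm exceeds 1, so that mach_fn is at
    most (1 - n) ln M up to a constant. *)
Lemma mach_fn_large g z : 1 < g -> exists x, 1 < x /\ mach_fn g x < z.
Proof.
  intros Hg; set (n := (g + 1) / (g - 1)).
  assert (Hn1 : n - 1 = 2 / (g - 1)) by (unfold n; field; lra).
  assert (Hn : 0 < n - 1) by (rewrite Hn1; apply Rdiv_lt_0_compat; lra).
  set (y := (- z - n * ln (g - 1)) / (n - 1)).
  exists (Rmax 2 (exp y)); set (x := Rmax _ _).
  assert (Hx : 2 <= x) by apply Rmax_l.
  assert (Hx2 : y <= ln x).
  { rewrite <- (ln_exp y); apply ln_le; [apply exp_pos | apply Rmax_r]. }
  split; [lra|]. unfold mach_fn; fold n.
  assert (ln ((g - 1) * x) < ln ((g - 1) * x + 2)) by (apply ln_increasing; nra).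
  rewrite ln_mult in H by lra.
  assert ((n - 1) * y = - z - n * ln (g - 1)) by (unfold y; field; lra).
  nra.
Qed.

(** The reciprocal of the derivative of [mach_fn]. *)
Definition mach_slope_inv (g M : R) : R := M * ((g - 1) * M + 2) / (2 * (1 - M)).

(** A smooth right inverse of [mach_fn] below the sonic level, on the side P of
    M = 1. *)
Definition mach_branch (g : R) (P : R -> Prop) (br : R -> R) : Prop :=
  (forall z, z < mach_fn g 1 -> 0 < br z /\ P (br z) /\ mach_fn g (br z) = z)
  /\ Cinf (fun z => z < mach_fn g 1) br.

(** A branch solves dM/dz = [mach_slope_inv] M, whose right side is smooth away
    from M = 1, a value that no branch takes below the sonic level. *)
Lemma Cinf_mach_branch g (br : R -> R) :
  1 < g ->
  (forall z, z < mach_fn g 1 -> 0 < br z /\ mach_fn g (br z) = z) ->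
  (forall z, z < mach_fn g 1 -> continuous br z) ->
  Cinf (fun z => z < mach_fn g 1) br.
Proof.
  intros Hg Hbr Hc.
  assert (H1 : forall z, z < mach_fn g 1 -> br z <> 1).
  { intros z Hz E; destruct (Hbr z Hz) as [_ H]; rewrite E in H; lra. }
  apply (Cinf_autonomous _ (fun M => M <> 1) (mach_slope_inv g)); auto.
  - unfold mach_slope_inv; apply Cinf_div; [intros x Hx H; apply Hx; lra | |].
    + apply Cinf_mult; [apply Cinf_id|].
      apply Cinf_plus; [|apply Cinf_const].
      apply Cinf_mult; [apply Cinf_const | apply Cinf_id].
    + apply Cinf_mult; [apply Cinf_const|].
      apply Cinf_minus; [apply Cinf_const | apply Cinf_id].
  - intros z Hz; destruct (Hbr z Hz) as [H0 _]; specialize (H1 z Hz).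
    set (M := br z) in *.
    assert (Hp : 0 < (g - 1) * M + 2) by nra.
    replace (mach_slope_inv g M)
      with (/ (2 * (1 - M) / (M * ((g - 1) * M + 2)))).
    2:{ unfold mach_slope_inv; field; repeat split; lra. }
    apply (is_derive_inverse (mach_fn g)); auto.
    + apply is_derive_mach_fn; auto.
    + apply Rmult_integral_contrapositive_currified; [lra|].
      apply Rinv_neq_0_compat; nra.
    + generalize (open_lt (mach_fn g 1) z Hz); apply filter_imp.
      intros w Hw; apply Hbr, Hw.
Qed.

Lemma subsonic_branch_exists g :
  1 < g -> exists br, mach_branch g (fun M => M < 1) br.
Proof.
  intros Hg.
  assert (Ex : forall z, exists M,
    z < mach_fn g 1 -> 0 < M /\ M < 1 /\ mach_fn g M = z).
  { intros z; destruct (Rlt_le_dec z (mach_fn g 1)) as [Hz|Hz]; [|exists 0; lra].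
    destruct (mach_fn_small g z Hg) as [x [Hx Hxz]].
    destruct (mach_fn_attains g x 1 z) as [M [HM E]]; try lra.
    rewrite Rmin_left, Rmax_right in HM by lra.
    exists M; lra. }
  destruct (functional_choice _ Ex) as [br Hbr].
  exists br; split; [exact Hbr|].
  apply Cinf_mach_branch; auto; [intros z Hz; split; apply Hbr; auto|].
  intros z Hz.
  apply (continuous_increasing_inverse (mach_fn g) _ 0 1 (fun z => z < mach_fn g 1));
    auto using open_lt; simpl.
  intros x y ? ? ?; apply mach_fn_increasing; lra.
Qed.

Lemma supersonic_branch_exists g :
  1 < g -> exists br, mach_branch g (fun M => 1 < M) br.
Proof.
  intros Hg.
  assert (Ex : forall z, exists M,
    z < mach_fn g 1 -> 0 < M /\ 1 < M /\ mach_fn g M = z).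
  { intros z; destruct (Rlt_le_dec z (mach_fn g 1)) as [Hz|Hz]; [|exists 0; lra].
    destruct (mach_fn_large g z Hg) as [x [Hx Hxz]].
    destruct (mach_fn_attains g x 1 z) as [M [HM E]]; try lra.
    rewrite Rmin_right, Rmax_left in HM by lra.
    exists M; lra. }
  destruct (functional_choice _ Ex) as [br Hbr].
  exists br; split; [exact Hbr|].
  apply Cinf_mach_branch; auto; [intros z Hz; split; apply Hbr; auto|].
  intros z Hz.
  (* br is an inverse of a decreasing function: reflect the argument. *)
  assert (C : continuous (fun w => br (- w)) (- z)).
  { apply (continuous_increasing_inverse (fun M => - mach_fn g M) _ 1 p_infty
      (fun w => - mach_fn g 1 < w)); auto using open_gt; simpl; try lra.
    - intros x y ? ? _; assert (mach_fn g y < mach_fn g x); [|lra].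
      apply mach_fn_decreasing; lra.
    - intros w Hw; destruct (Hbr (- w)) as [? [? E]]; [lra|].
      rewrite E; repeat split; auto; lra. }
  apply (continuous_ext (fun w => br (- - w))); [intros w; now rewrite Ropp_involutive|].
  apply (continuous_comp Ropp (fun w => br (- w))); auto.
  apply (continuous_opp (V := R_NormedModule)), continuous_id.
Qed.

Lemma supersonic_branch_decreasing g br z w :
  1 < g -> mach_branch g (fun M => 1 < M) br -> z < w -> w < mach_fn g 1 ->
  br w < br z.
Proof.
  intros Hg [H _] Hz Hw.
  destruct (H z) as [Z0 [Z1 Z2]]; [lra|]; destruct (H w) as [W0 [W1 W2]]; [lra|].
  destruct (Rlt_le_dec (br w) (br z)) as [|[L|L]]; auto; exfalso.
  - generalize (mach_fn_decreasing g (br z) (br w)); lra.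
  - rewrite L in Z2; lra.
Qed.

Lemma subsonic_branch_increasing g br z w :
  1 < g -> mach_branch g (fun M => M < 1) br -> z < w -> w < mach_fn g 1 ->
  br z < br w.
Proof.
  intros Hg [H _] Hz Hw.
  destruct (H z) as [Z0 [Z1 Z2]]; [lra|]; destruct (H w) as [W0 [W1 W2]]; [lra|].
  destruct (Rlt_le_dec (br z) (br w)) as [|[L|L]]; auto; exfalso.
  - generalize (mach_fn_increasing g (br w) (br z)); lra.
  - rewrite L in W2; lra.
Qed.

(** * One-dimensional states *)

Lemma Rpower_pos x y : 0 < Rpower x y.
Proof. apply exp_pos. Qed.

Lemma Rpower_inj x y z : 0 < x -> 0 < y -> z <> 0 -> Rpower x z = Rpower y z -> x = y.
Proof.
  intros Hx Hy Hz E; apply ln_inv; auto.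
  apply exp_inv in E. now apply Rmult_eq_reg_l in E.
Qed.

Lemma Rpower_pred x g : 0 < x -> Rpower x g = x * Rpower x (g - 1).
Proof.
  intros; rewrite <- (Rpower_1 x) at 2 by auto.
  rewrite <- Rpower_plus; f_equal; ring.
Qed.

(** The square of the sound speed. *)
Definition csq (g A rh : R) : R := g * A * Rpower rh (g - 1).

(** Here A is the entropy, m the mass flux and E the stagnation energy. *)
Definition radial_state (g m E A rh u : R) : Prop :=
  0 < A /\ 0 < rh /\ 0 < u /\ rh * u = m /\ u ^ 2 / 2 + csq g A rh / (g - 1) = E.

(** The value of [mach_fn] forced by mass flux m, energy E and entropy A. *)
Definition mach_level (g m E A : R) : R :=
  2 * ln m - (g + 1) / (g - 1) * ln (2 * (g - 1) * E) + 2 / (g - 1) * ln (g * A).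

Definition machsq (g A rh u : R) : R := u ^ 2 / csq g A rh.

Lemma csq_pos g A rh : 1 < g -> 0 < A -> 0 < csq g A rh.
Proof.
  intros; unfold csq; apply Rmult_lt_0_compat; [nra | apply Rpower_pos].
Qed.

Lemma state_energy_pos g m E A rh u : 1 < g -> radial_state g m E A rh u -> 0 < E.
Proof.
  intros Hg [HA [Hr [Hu [_ <-]]]]; assert (C := csq_pos g A rh Hg HA).
  assert (0 < csq g A rh / (g - 1)) by (apply Rdiv_lt_0_compat; lra). nra.
Qed.

Lemma machsq_pos g A rh u : 1 < g -> 0 < A -> 0 < u -> 0 < machsq g A rh u.
Proof.
  intros; apply Rdiv_lt_0_compat; [nra | apply csq_pos; auto].
Qed.

Lemma state_csq g m E A rh u :
  1 < g -> radial_state g m E A rh u ->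
  csq g A rh = 2 * (g - 1) * E / ((g - 1) * machsq g A rh u + 2).
Proof.
  intros Hg [HA [Hr [Hu [_ <-]]]]; assert (C := csq_pos g A rh Hg HA).
  unfold machsq; set (a := csq g A rh) in *; field; repeat split; nra.
Qed.

(** With a = c^2 one has ln a = ln (g A) + (g-1) ln rh and
    (g-1) M + 2 = 2 (g-1) E / a; eliminating ln rh and ln a between these
    relations and ln m = ln rh + ln u leaves only M. *)
Lemma state_mach g m E A rh u :
  1 < g -> radial_state g m E A rh u ->
  mach_fn g (machsq g A rh u) = mach_level g m E A.
Proof.
  intros Hg [HA [Hr [Hu [<- <-]]]]; assert (C := csq_pos g A rh Hg HA).
  assert (LC : ln (csq g A rh) = ln (g * A) + (g - 1) * ln rh).
  { unfold csq; rewrite ln_mult by (try apply Rpower_pos; nra).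
    unfold Rpower; now rewrite ln_exp. }
  unfold mach_fn, mach_level, machsq; set (a := csq g A rh) in *.
  replace ((g - 1) * (u ^ 2 / a) + 2) with (2 * (g - 1) * (u ^ 2 / 2 + a / (g - 1)) / a)
    by (field; lra).
  assert (0 < 2 * (g - 1) * (u ^ 2 / 2 + a / (g - 1))).
  { apply Rmult_lt_0_compat; [lra|].
    assert (0 < a / (g - 1)) by (apply Rdiv_lt_0_compat; lra). nra. }
  set (X := 2 * (g - 1) * _) in *.
  rewrite !ln_div, ln_mult by (auto; nra).
  replace (ln (u ^ 2)) with (2 * ln u).
  2:{ simpl; rewrite Rmult_1_r, ln_mult by auto; ring. }
  rewrite LC; field; lra.
Qed.

(** The density at which c^2 = c. *)
Definition rho_of (g A c : R) : R := Rpower (c / (g * A)) (/ (g - 1)).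

(** The energy equation solved for c^2, given M = u^2 / c^2. *)
Definition csq_of (g E M : R) : R := 2 * (g - 1) * E / ((g - 1) * M + 2).

Lemma csq_of_pos g E M : 1 < g -> 0 < E -> 0 < M -> 0 < csq_of g E M.
Proof. intros; apply Rdiv_lt_0_compat; nra. Qed.

Lemma csq_rho_of g A c : 1 < g -> 0 < A -> 0 < c -> csq g A (rho_of g A c) = c.
Proof.
  intros Hg HA Hc; unfold csq, rho_of; rewrite Rpower_mult.
  replace (/ (g - 1) * (g - 1)) with 1 by (field; lra).
  rewrite Rpower_1 by (apply Rdiv_lt_0_compat; nra). field; split; lra.
Qed.

(** Converse of [state_mach]: the energy equation gives c^2, entropy and c^2
    give the density, and the level equation makes m / rh the velocity with Mach
    number M. *)
Lemma state_of_mach g m E A M :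
  1 < g -> 0 < m -> 0 < E -> 0 < A -> 0 < M -> mach_fn g M = mach_level g m E A ->
  let rh := rho_of g A (csq_of g E M) in
  radial_state g m E A rh (m / rh) /\ machsq g A rh (m / rh) = M
  /\ csq g A rh = csq_of g E M.
Proof.
  intros Hg Hm HE HA HM HL rh.
  assert (Hr : 0 < rh) by apply Rpower_pos.
  assert (Hc : 0 < csq_of g E M) by (apply csq_of_pos; auto).
  assert (EC : csq g A rh = csq_of g E M) by (apply csq_rho_of; auto).
  assert (EM : (m / rh) ^ 2 = M * csq_of g E M).
  { assert (0 < m / rh) by (apply Rdiv_lt_0_compat; auto).
    apply ln_inv; [nra | nra |].
    simpl; rewrite Rmult_1_r, !ln_mult, ln_div by auto.
    replace (ln rh) with (/ (g - 1) * (ln (csq_of g E M) - ln (g * A))).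
    2:{ unfold rh, rho_of, Rpower; rewrite ln_exp, ln_div; nra. }
    unfold mach_fn, mach_level in HL.
    replace (ln (csq_of g E M)) with (ln (2 * (g - 1) * E) - ln ((g - 1) * M + 2)).
    2:{ unfold csq_of; rewrite ln_div; nra. }
    apply (Rmult_eq_compat_l (g - 1)) in HL.
    apply (Rmult_eq_reg_l (g - 1)); [|lra].
    field_simplify in HL; [|lra|lra]. field_simplify; [|lra]. lra. }
  split; [|split; auto].
  - repeat split; auto; [apply Rdiv_lt_0_compat; auto | field; lra |].
    rewrite EM, EC; unfold csq_of; field; split; nra.
  - unfold machsq; rewrite EC, EM; field; lra.
Qed.

(** On either side of M = 1 the function [mach_fn] is injective, so that the
    Mach numbers agree; then c^2, the density and the velocity agree too. *)
Lemma state_unique g m E A rh u rh' u' :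
  1 < g -> radial_state g m E A rh u -> radial_state g m E A rh' u' ->
  0 < (machsq g A rh u - 1) * (machsq g A rh' u' - 1) -> rh = rh' /\ u = u'.
Proof.
  intros Hg S S' Hs.
  assert (EM : machsq g A rh u = machsq g A rh' u').
  { apply (mach_fn_inj g); auto.
    - destruct S as [HA [_ [Hu _]]]; now apply machsq_pos.
    - destruct S' as [HA [_ [Hu _]]]; now apply machsq_pos.
    - now rewrite (state_mach g m E), (state_mach g m E). }
  assert (Ec : csq g A rh = csq g A rh').
  { rewrite (state_csq g m E A rh u), (state_csq g m E A rh' u'), EM by auto; auto. }
  destruct S as [HA [Hr [Hu [Em _]]]], S' as [_ [Hr' [Hu' [Em' _]]]].
  assert (rh = rh').
  { apply (Rpower_inj _ _ (g - 1)); auto; [lra|].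
    unfold csq in Ec; apply Rmult_eq_reg_l in Ec; nra. }
  split; auto; subst rh'. apply (Rmult_eq_reg_l rh); lra.
Qed.

(** The pressure as a function of the Mach number: g p = m c^2 / u, and
    (c^2 / u)^2 = c^2 / M. *)
Definition pressure_of (g m E M : R) : R :=
  m / g * sqrt (2 * (g - 1) * E / (M * ((g - 1) * M + 2))).

Lemma pressure_csq g A rh :
  1 < g -> 0 < rh -> A * Rpower rh g = rh * csq g A rh / g.
Proof.
  intros; unfold csq; rewrite Rpower_pred by auto; field; lra.
Qed.

Lemma state_pressure g m E A rh u :
  1 < g -> radial_state g m E A rh u ->
  A * Rpower rh g = pressure_of g m E (machsq g A rh u).
Proof.
  intros Hg S; assert (EC := state_csq _ _ _ _ _ _ Hg S).
  destruct S as [HA [Hr [Hu [Em _]]]].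
  assert (C := csq_pos g A rh Hg HA).
  assert (HM := machsq_pos g A rh u Hg HA Hu).
  rewrite pressure_csq by auto; unfold pressure_of.
  replace (2 * (g - 1) * E / (machsq g A rh u * ((g - 1) * machsq g A rh u + 2)))
    with (csq g A rh / machsq g A rh u).
  2:{ rewrite EC at 1; field; split; nra. }
  replace (csq g A rh / machsq g A rh u) with ((csq g A rh / u) ^ 2).
  2:{ unfold machsq; field; split; lra. }
  rewrite sqrt_pow2; [|apply Rlt_le, Rdiv_lt_0_compat; auto].
  rewrite <- Em; field; split; lra.
Qed.

Lemma pressure_of_decreasing g m E M N :
  1 < g -> 0 < m -> 0 < E -> 0 < M -> M < N ->
  pressure_of g m E N < pressure_of g m E M.
Proof.
  intros Hg Hm HE HM HMN; unfold pressure_of.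
  assert (0 < (g - 1) * E) by nra.
  assert (0 < M * ((g - 1) * M + 2)) by (apply Rmult_lt_0_compat; nra).
  assert (0 < (g - 1) * (N - M)) by nra.
  assert (M * ((g - 1) * M + 2) < N * ((g - 1) * N + 2)) by nra.
  apply Rmult_lt_compat_l; [apply Rdiv_lt_0_compat; lra|].
  apply sqrt_lt_1_alt; split.
  - apply Rlt_le, Rdiv_lt_0_compat; nra.
  - apply Rmult_lt_compat_l; [nra|]. apply Rinv_lt_contravar; auto.
    apply Rmult_lt_0_compat; lra.
Qed.

(** * The normal shock *)

(** The density ratio across a normal shock with upstream Mach number M; it is
    also the ratio of the upstream to the downstream velocity. *)
Definition jump (g M : R) : R := (g + 1) * M / ((g - 1) * M + 2).

(** The ratio of the entropies A behind and ahead of a normal shock with density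
    ratio x. *)
Definition entropy_jump (g x : R) : R :=
  ((g + 1) * x - (g - 1)) / ((g + 1) - (g - 1) * x) * Rpower x (- g).

Lemma jump_bounds g M :
  1 < g -> 1 < M -> 1 < jump g M /\ (g - 1) * jump g M < g + 1.
Proof.
  intros Hg HM; unfold jump.
  assert (0 < (g - 1) * M + 2) by nra.
  split.
  - apply (Rmult_lt_reg_r ((g - 1) * M + 2)); auto. field_simplify; nra.
  - apply (Rmult_lt_reg_r ((g - 1) * M + 2)); auto. field_simplify; nra.
Qed.

Lemma jump_increasing g M N :
  1 < g -> 0 < M -> M < N -> jump g M < jump g N.
Proof.
  intros Hg HM HN; unfold jump.
  assert (0 < (g - 1) * M + 2) by nra.
  assert (0 < (g - 1) * N + 2) by nra.
  apply Rlt_0_minus.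
  replace ((g + 1) * N / ((g - 1) * N + 2) - (g + 1) * M / ((g - 1) * M + 2))
    with (2 * (g + 1) * (N - M) / (((g - 1) * N + 2) * ((g - 1) * M + 2)))
    by (field; lra).
  apply Rdiv_lt_0_compat; nra.
Qed.

Lemma entropy_jump_exp g x :
  1 < g -> 1 <= x -> (g - 1) * x < g + 1 ->
  entropy_jump g x
  = exp (ln ((g + 1) * x - (g - 1)) - ln ((g + 1) - (g - 1) * x) - g * ln x).
Proof.
  intros Hg H1 H2; unfold entropy_jump, Rpower.
  rewrite <- ln_div by nra.
  set (q := (_ / _)); replace (ln q - g * ln x) with (ln q + - g * ln x) by ring.
  rewrite exp_plus, exp_ln; auto. apply Rdiv_lt_0_compat; nra.
Qed.

(** The logarithmic derivative is
    g (g^2 - 1) (x - 1)^2 / (x ((g+1) x - (g-1)) ((g+1) - (g-1) x)).  It has a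
    double zero at x = 1, the weak shock limit, and is positive beyond. *)
Lemma entropy_jump_increasing g x y :
  1 < g -> 1 <= x -> x < y -> (g - 1) * y < g + 1 ->
  entropy_jump g x < entropy_jump g y.
Proof.
  intros Hg H1 H2 H3.
  rewrite !entropy_jump_exp by nra; apply exp_increasing.
  apply (increasing_of_derivative
    (fun x => ln ((g + 1) * x - (g - 1)) - ln ((g + 1) - (g - 1) * x) - g * ln x)
    (fun x => g * (g ^ 2 - 1) * (x - 1) ^ 2
              / (x * ((g + 1) * x - (g - 1)) * ((g + 1) - (g - 1) * x)))); auto.
  - intros t Ht.
    assert (0 < (g + 1) * t - (g - 1)) by nra.
    assert (0 < (g + 1) - (g - 1) * t) by nra.
    auto_derive; [repeat split; lra|]. field; repeat split; lra.
  - intros t Ht.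
    assert (0 < (g + 1) * t - (g - 1)) by nra.
    assert (0 < (g + 1) - (g - 1) * t) by nra.
    apply Rdiv_lt_0_compat.
    + assert (0 < (t - 1) ^ 2) by nra.
      apply Rmult_lt_0_compat; [|auto]. apply Rmult_lt_0_compat; nra.
    + repeat apply Rmult_lt_0_compat; lra.
Qed.

Lemma entropy_jump_pos g x :
  1 < g -> 1 <= x -> (g - 1) * x < g + 1 -> 0 < entropy_jump g x.
Proof. intros; rewrite entropy_jump_exp by auto; apply exp_pos. Qed.

(** The product of the velocities on the two sides of a normal shock. *)
Definition prandtl (g E : R) : R := 2 * (g - 1) / (g + 1) * E.

Lemma state_csq_prandtl g m E A rh u :
  1 < g -> radial_state g m E A rh u ->
  csq g A rh = (g + 1) / 2 * prandtl g E - (g - 1) / 2 * u ^ 2.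
Proof.
  intros Hg [_ [_ [_ [_ <-]]]]; unfold prandtl; field; lra.
Qed.

(** This is u / u' for u u' equal to [prandtl g E]. *)
Lemma jump_prandtl g m E A rh u :
  1 < g -> radial_state g m E A rh u ->
  jump g (machsq g A rh u) = u ^ 2 / prandtl g E.
Proof.
  intros Hg [HA [Hr [Hu [_ <-]]]]; assert (C := csq_pos g A rh Hg HA).
  unfold jump, machsq, prandtl; set (a := csq g A rh) in *.
  field; repeat split; nra.
Qed.

Lemma prandtl_pos g E : 1 < g -> 0 < E -> 0 < prandtl g E.
Proof.
  intros; unfold prandtl; apply Rmult_lt_0_compat; auto.
  apply Rdiv_lt_0_compat; lra.
Qed.

Lemma machsq_lt_1 g A rh u :
  1 < g -> 0 < A -> (machsq g A rh u < 1 <-> u ^ 2 < csq g A rh).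
Proof.
  intros Hg HA; assert (C := csq_pos g A rh Hg HA); unfold machsq.
  split; intros H.
  - apply (Rmult_lt_compat_r (csq g A rh)) in H; auto.
    unfold Rdiv in H; rewrite Rmult_assoc, Rinv_l in H; lra.
  - apply (Rmult_lt_reg_r (csq g A rh)); auto.
    unfold Rdiv; rewrite Rmult_assoc, Rinv_l; lra.
Qed.

Lemma machsq_gt_1 g A rh u :
  1 < g -> 0 < A -> (1 < machsq g A rh u <-> csq g A rh < u ^ 2).
Proof.
  intros Hg HA; assert (C := csq_pos g A rh Hg HA); unfold machsq.
  split; intros H.
  - apply (Rmult_lt_compat_r (csq g A rh)) in H; auto.
    unfold Rdiv in H; rewrite Rmult_assoc, Rinv_l in H; lra.
  - apply (Rmult_lt_reg_r (csq g A rh)); auto.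
    unfold Rdiv; rewrite Rmult_assoc, Rinv_l; lra.
Qed.

Definition momentum (g A rh u : R) : R := rh * u ^ 2 + A * Rpower rh g.

(** Since W = u^2 / x is the Prandtl product, c^2 is (g+1)/2 W - (g-1)/2 v^2 at
    velocity v on both sides, that is, rational in x up to the factor u^2.  The
    inequalities come from 1 < x < (g+1)/(g-1). *)
Lemma shock_behind g m E A rh u :
  1 < g -> radial_state g m E A rh u -> 1 < machsq g A rh u ->
  let x := jump g (machsq g A rh u) in
  let A' := A * entropy_jump g x in
  radial_state g m E A' (rh * x) (u / x)
  /\ machsq g A' (rh * x) (u / x) < 1
  /\ momentum g A' (rh * x) (u / x) = momentum g A rh u
  /\ A * Rpower rh g < A' * Rpower (rh * x) g.
Proof.
  intros Hg S HM x A'.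
  destruct (jump_bounds g _ Hg HM) as [X1 X2]; fold x in X1, X2.
  assert (HE := state_energy_pos _ _ _ _ _ _ Hg S).
  assert (W := prandtl_pos g E Hg HE).
  assert (EW : prandtl g E = u ^ 2 / x).
  { unfold x; rewrite (jump_prandtl g m E) by auto.
    destruct S as [_ [_ [Hu _]]]; field; split; lra. }
  assert (EA := state_csq_prandtl _ _ _ _ _ _ Hg S).
  assert (EE : E = (g + 1) / (2 * (g - 1)) * (u ^ 2 / x)).
  { rewrite <- EW; unfold prandtl; field; lra. }
  destruct S as [HA [Hr [Hu [Em Ee]]]].
  assert (C := csq_pos g A rh Hg HA).
  assert (HA' : 0 < A') by (apply Rmult_lt_0_compat; [|apply entropy_jump_pos]; lra).
  assert (Ec : csq g A' (rh * x) = ((g + 1) * x - (g - 1)) * u ^ 2 / (2 * x ^ 2)).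
  { unfold csq, A', entropy_jump.
    rewrite <- Rpower_mult_distr by lra.
    replace (g * (A * (((g + 1) * x - (g - 1)) / (g + 1 - (g - 1) * x) * Rpower x (- g)))
             * (Rpower rh (g - 1) * Rpower x (g - 1)))
      with (csq g A rh * (((g + 1) * x - (g - 1)) / (g + 1 - (g - 1) * x))
            * (Rpower x (- g) * Rpower x (g - 1))) by (unfold csq; ring).
    rewrite <- Rpower_plus; replace (- g + (g - 1)) with (- (1)) by ring.
    rewrite Rpower_Ropp, Rpower_1, EA, EW by lra.
    field; repeat split; lra. }
  assert (Hx2 : 0 < u ^ 2 / (2 * x ^ 2)) by (apply Rdiv_lt_0_compat; nra).
  assert (S' : radial_state g m E A' (rh * x) (u / x)).
  { repeat split; auto; [nra | apply Rdiv_lt_0_compat; lra | rewrite <- Em; field; lra |].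
    rewrite Ec, EE; field; split; lra. }
  split; auto; split; [|split].
  - apply machsq_lt_1; auto; rewrite Ec.
    replace ((u / x) ^ 2) with (2 * (u ^ 2 / (2 * x ^ 2))) by (field; lra).
    replace (((g + 1) * x - (g - 1)) * u ^ 2 / (2 * x ^ 2))
      with (((g + 1) * x - (g - 1)) * (u ^ 2 / (2 * x ^ 2))) by (field; lra).
    apply Rmult_lt_compat_r; nra.
  - unfold momentum; rewrite !pressure_csq, Ec, EA, EW by nra. field; split; lra.
  - rewrite !pressure_csq, Ec, EA, EW by nra.
    replace (rh * ((g + 1) / 2 * (u ^ 2 / x) - (g - 1) / 2 * u ^ 2) / g)
      with (rh / g * (u ^ 2 / (2 * x ^ 2)) * (x * ((g + 1) - (g - 1) * x)))
      by (field; split; lra).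
    replace (rh * x * (((g + 1) * x - (g - 1)) * u ^ 2 / (2 * x ^ 2)) / g)
      with (rh / g * (u ^ 2 / (2 * x ^ 2)) * (x * ((g + 1) * x - (g - 1))))
      by (field; split; lra).
    apply Rmult_lt_compat_l.
    + apply Rmult_lt_0_compat; auto. apply Rdiv_lt_0_compat; lra.
    + apply Rmult_lt_compat_l; nra.
Qed.

(** As a function of the velocity at fixed m and E the momentum flux is
    m (g+1)/(2g) (u + W/u) with W = [prandtl g E]; two distinct velocities with
    the same momentum flux therefore have product W. *)
Lemma prandtl_relation g m E A rh u A' rh' u' :
  1 < g -> radial_state g m E A rh u -> radial_state g m E A' rh' u' ->
  momentum g A' rh' u' = momentum g A rh u -> u <> u' ->
  u * u' = prandtl g E.
Proof.
  intros Hg S S' EM Hne.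
  assert (EA := state_csq_prandtl _ _ _ _ _ _ Hg S).
  assert (EA' := state_csq_prandtl _ _ _ _ _ _ Hg S').
  destruct S as [HA [Hr [Hu [Em _]]]], S' as [HA' [Hr' [Hu' [Em' _]]]].
  unfold momentum in EM; rewrite !pressure_csq, EA, EA' in EM by auto.
  set (W := prandtl g E) in *; clearbody W.
  assert (E1 : rh = m / u) by (rewrite <- Em; field; lra).
  assert (E2 : rh' = m / u') by (rewrite <- Em'; field; lra).
  assert (Hm : 0 < m) by nra.
  rewrite E1, E2 in EM.
  apply Rminus_diag_eq in EM.
  assert (F : m * (g + 1) / (2 * g * (u * u')) * (u' - u) * (u * u' - W) = 0).
  { rewrite <- EM; field; repeat split; lra. }
  apply Rmult_integral in F; destruct F as [F|F]; [|lra].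
  apply Rmult_integral in F; destruct F as [F|F]; [|lra].
  assert (0 < m * (g + 1) / (2 * g * (u * u'))); [|lra].
  apply Rdiv_lt_0_compat; repeat apply Rmult_lt_0_compat; lra.
Qed.

(** The pressure rise excludes u = u', so the Prandtl relation gives u'.  The
    density follows from the mass flux and the entropy from the energy. *)
Lemma shock_unique g m E A rh u A' rh' u' :
  1 < g -> radial_state g m E A rh u -> 1 < machsq g A rh u ->
  radial_state g m E A' rh' u' ->
  momentum g A' rh' u' = momentum g A rh u -> A * Rpower rh g < A' * Rpower rh' g ->
  let x := jump g (machsq g A rh u) in
  rh' = rh * x /\ u' = u / x /\ A' = A * entropy_jump g x.
Proof.
  intros Hg S HM S' EM Hp x.
  assert (Hne : u <> u').
  { intros E1; destruct S as [_ [Hr [Hu [E2 _]]]], S' as [_ [Hr' [_ [E3 _]]]].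
    assert (rh = rh') by (apply (Rmult_eq_reg_r u); [|lra]; congruence).
    subst; unfold momentum in EM; lra. }
  assert (W := prandtl_relation _ _ _ _ _ _ _ _ _ Hg S S' EM Hne).
  destruct (jump_bounds g _ Hg HM) as [X1 X2]; fold x in X1, X2.
  assert (HW := prandtl_pos g E Hg (state_energy_pos _ _ _ _ _ _ Hg S)).
  assert (Hx : x = u ^ 2 / prandtl g E) by (unfold x; rewrite (jump_prandtl g m E); auto).
  assert (Eu : u' = u / x).
  { rewrite Hx, <- W; destruct S as [_ [_ [Hu _]]], S' as [_ [_ [Hu' _]]]; field; lra. }
  destruct (shock_behind _ _ _ _ _ _ Hg S HM) as [S2 _]; fold x in S2.
  assert (Er : rh' = rh * x).
  { destruct S as [_ [Hr [Hu [E2 _]]]], S' as [_ [Hr' [Hu' [E3 _]]]].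
    apply (Rmult_eq_reg_r u'); [|lra]. rewrite E3, Eu, <- E2; field; lra. }
  repeat split; auto.
  assert (C1 := state_csq_prandtl _ _ _ _ _ _ Hg S').
  assert (C2 := state_csq_prandtl _ _ _ _ _ _ Hg S2).
  rewrite <- Eu, <- C1, Er in C2; unfold csq in C2.
  assert (Q := Rpower_pos (rh * x) (g - 1)).
  apply Rmult_eq_reg_r in C2; [|lra]. apply Rmult_eq_reg_l in C2; lra.
Qed.

(** * Radial flows with given constants of motion *)

(** The stagnation energy left to the radial motion once the kinetic energy of
    the swirl U2 = k2 / r is removed. *)
Definition radial_energy (B k2 r : R) : R := B - k2 ^ 2 / (2 * r ^ 2).

Definition flow_level (g k1 k2 B A r : R) : R :=
  mach_level g (k1 / r) (radial_energy B k2 r) A.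

Lemma radial_energy_increasing B k2 r s :
  0 < r -> r <= s -> radial_energy B k2 r <= radial_energy B k2 s.
Proof.
  intros Hr Hs; unfold radial_energy.
  apply Rplus_le_compat_l, Ropp_le_contravar.
  apply Rmult_le_compat_l; [nra|]. apply Rinv_le_contravar; nra.
Qed.

(** Both the decrease of the mass flux k1 / r and the increase of the radial
    energy lower the level. *)
Lemma flow_level_decreasing g k1 k2 B A r s :
  1 < g -> 0 < k1 -> 0 < r -> r < s -> 0 < radial_energy B k2 r ->
  flow_level g k1 k2 B A s < flow_level g k1 k2 B A r.
Proof.
  intros Hg Hk Hr Hs HE; unfold flow_level, mach_level.
  assert (L1 : ln (k1 / s) < ln (k1 / r)).
  { apply ln_increasing; [apply Rdiv_lt_0_compat; lra|].
    apply Rmult_lt_compat_l; auto. apply Rinv_lt_contravar; nra. }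
  assert (H : radial_energy B k2 r <= radial_energy B k2 s)
    by (apply radial_energy_increasing; lra).
  assert (L2 : ln (2 * (g - 1) * radial_energy B k2 r)
               <= ln (2 * (g - 1) * radial_energy B k2 s)).
  { apply ln_le; [apply Rmult_lt_0_compat; lra|]. apply Rmult_le_compat_l; lra. }
  assert (0 < (g + 1) / (g - 1)) by (apply Rdiv_lt_0_compat; lra).
  apply (Rmult_le_compat_l ((g + 1) / (g - 1))) in L2; lra.
Qed.

Lemma flow_level_entropy g k1 k2 B A A' r :
  1 < g -> 0 < A -> A < A' -> flow_level g k1 k2 B A r < flow_level g k1 k2 B A' r.
Proof.
  intros Hg HA HA'; unfold flow_level, mach_level.
  apply Rplus_lt_compat_l, Rmult_lt_compat_l; [apply Rdiv_lt_0_compat; lra|].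
  apply ln_increasing; nra.
Qed.

(** The flow with mass flux constant k1, angular momentum k2, Bernoulli
    constant B and entropy a whose radial Mach number is read off the branch br. *)
Definition branch_flow (g k1 k2 B a : R) (br : R -> R) : flow :=
  let rh := fun r =>
    rho_of g a (csq_of g (radial_energy B k2 r) (br (flow_level g k1 k2 B a r))) in
  Flow (fun r => k1 / r / rh r) (fun r => k2 / r) rh (fun _ => a).

(** The radii at which both branches are defined. *)
Definition admissible (g k1 k2 B a r : R) : Prop :=
  0 < r /\ 0 < radial_energy B k2 r /\ flow_level g k1 k2 B a r < mach_fn g 1.

(** The four constants of motion, as conditions at a single radius. *)
Definition invariants (g k1 k2 B a : R) (F : flow) (r : R) : Prop :=
  0 < rho F r /\ A F r = a /\ r * (rho F r * U1 F r) = k1 /\ r * U2 F r = k2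
  /\ bernoulli g F r = B.

Definition radial_mach (g : R) (F : flow) (r : R) : R :=
  machsq g (A F r) (rho F r) (U1 F r).

Lemma pressure_over_rho g F r :
  0 < rho F r -> g * pressure g F r / rho F r = csq g (A F r) (rho F r).
Proof.
  intros H; unfold pressure, csq; rewrite Rpower_pred by auto; field; lra.
Qed.

Lemma bernoulli_csq g F r :
  1 < g -> 0 < rho F r ->
  bernoulli g F r
  = (U1 F r ^ 2 + U2 F r ^ 2) / 2 + csq g (A F r) (rho F r) / (g - 1).
Proof.
  intros Hg H; unfold bernoulli; rewrite <- pressure_over_rho by auto.
  field; lra.
Qed.

Lemma invariants_state g k1 k2 B a F r :
  1 < g -> 0 < a -> 0 < k1 -> 0 < r -> invariants g k1 k2 B a F r ->
  radial_state g (k1 / r) (radial_energy B k2 r) a (rho F r) (U1 F r).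
Proof.
  intros Hg Ha Hk Hr [H1 [H2 [H3 [H4 H5]]]].
  rewrite bernoulli_csq, H2 in H5 by auto.
  repeat split; auto.
  - destruct (Rlt_le_dec 0 (U1 F r)) as [|L]; auto.
    assert (rho F r * U1 F r <= 0) by nra. nra.
  - rewrite <- H3; field; lra.
  - unfold radial_energy; rewrite <- H5, <- H4; field; lra.
Qed.

Lemma branch_flow_state g k1 k2 B a P br r :
  1 < g -> 0 < a -> 0 < k1 -> mach_branch g P br -> admissible g k1 k2 B a r ->
  let F := branch_flow g k1 k2 B a br in
  radial_state g (k1 / r) (radial_energy B k2 r) a (rho F r) (U1 F r)
  /\ radial_mach g F r = br (flow_level g k1 k2 B a r)
  /\ csq g a (rho F r)
     = csq_of g (radial_energy B k2 r) (br (flow_level g k1 k2 B a r)).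
Proof.
  intros Hg Ha Hk [Hbr _] [Hr [HE HL]] F.
  destruct (Hbr _ HL) as [M0 [_ ML]].
  apply state_of_mach; auto. apply Rdiv_lt_0_compat; auto.
Qed.

Lemma branch_flow_invariants g k1 k2 B a P br r :
  1 < g -> 0 < a -> 0 < k1 -> mach_branch g P br -> admissible g k1 k2 B a r ->
  invariants g k1 k2 B a (branch_flow g k1 k2 B a br) r.
Proof.
  intros Hg Ha Hk Hbr Hadm.
  destruct (branch_flow_state _ _ _ _ _ _ _ _ Hg Ha Hk Hbr Hadm)
    as [[_ [H1 [H2 [H3 H4]]]] _].
  destruct Hadm as [Hr _].
  set (F := branch_flow g k1 k2 B a br) in *.
  repeat split; auto.
  - rewrite H3; field; lra.
  - simpl; field; lra.
  - rewrite bernoulli_csq by auto; change (A F r) with a.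
    replace ((U1 F r ^ 2 + U2 F r ^ 2) / 2 + csq g a (rho F r) / (g - 1))
      with (U1 F r ^ 2 / 2 + csq g a (rho F r) / (g - 1) + U2 F r ^ 2 / 2) by (field; lra).
    rewrite H4; simpl; unfold radial_energy; field; lra.
Qed.

Lemma Cinf_radial_energy (D : R -> Prop) B k2 :
  (forall r, D r -> 0 < r) -> Cinf D (radial_energy B k2).
Proof.
  intros HD; unfold radial_energy.
  apply Cinf_minus; [apply Cinf_const|].
  apply Cinf_div; [intros r Hr; specialize (HD r Hr); nra | apply Cinf_const |].
  apply Cinf_mult; [apply Cinf_const|]. simpl.
  repeat apply Cinf_mult; try apply Cinf_id. apply Cinf_const.
Qed.

Lemma Cinf_flow_level (D : R -> Prop) g k1 k2 B a :
  1 < g -> 0 < k1 -> (forall r, D r -> 0 < r /\ 0 < radial_energy B k2 r) ->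
  Cinf D (flow_level g k1 k2 B a).
Proof.
  intros Hg Hk HD; unfold flow_level, mach_level.
  apply Cinf_plus; [|apply Cinf_const].
  apply Cinf_minus; (apply Cinf_mult; [apply Cinf_const|]; apply Cinf_ln).
  - intros r Hr; apply Rdiv_lt_0_compat; auto; apply HD, Hr.
  - apply Cinf_div; [intros r Hr; specialize (HD r Hr); lra | apply Cinf_const |].
    apply Cinf_id.
  - intros r Hr; specialize (HD r Hr); apply Rmult_lt_0_compat; lra.
  - apply Cinf_mult; [apply Cinf_const | apply Cinf_radial_energy, HD].
Qed.

Lemma Cinf_branch_flow g k1 k2 B a P br :
  1 < g -> 0 < a -> 0 < k1 -> mach_branch g P br ->
  let D := admissible g k1 k2 B a in
  let F := branch_flow g k1 k2 B a br in
  Cinf D (U1 F) /\ Cinf D (U2 F) /\ Cinf D (rho F) /\ Cinf D (A F)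
  /\ Cinf D (fun r => br (flow_level g k1 k2 B a r)).
Proof.
  intros Hg Ha Hk [Hbr Sbr] D F.
  assert (HM : Cinf D (fun r => br (flow_level g k1 k2 B a r))).
  { apply (Cinf_comp D (fun z => z < mach_fn g 1)); auto; [now intros r [_ [_ H]]|].
    apply Cinf_flow_level; auto. now intros r [H1 [H2 _]]. }
  assert (HR : Cinf D (rho F)).
  { simpl; unfold rho_of, Rpower, csq_of.
    apply Cinf_exp, Cinf_mult; [apply Cinf_const|].
    assert (HP : forall r, D r -> 0 < (g - 1) * br (flow_level g k1 k2 B a r) + 2).
    { intros r [_ [_ H]]; destruct (Hbr _ H) as [H0 _]; nra. }
    apply Cinf_ln.
    - intros r Hr; apply Rdiv_lt_0_compat; [|nra].
      apply Rdiv_lt_0_compat; [|apply HP, Hr].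
      destruct Hr as [_ [H _]]; apply Rmult_lt_0_compat; lra.
    - apply Cinf_div; [intros; nra | | apply Cinf_const].
      apply Cinf_div; [intros r Hr E; specialize (HP r Hr); lra | |].
      + apply Cinf_mult; [apply Cinf_const|]. apply Cinf_radial_energy.
        now intros r [H _].
      + apply Cinf_plus; [|apply Cinf_const].
        apply Cinf_mult; [apply Cinf_const | auto]. }
  split; [|split; [|split; [exact HR|split; [|exact HM]]]].
  - change (U1 F) with (fun r => k1 / r / rho F r).
    apply Cinf_div; auto.
    + intros r _; apply Rgt_not_eq, Rpower_pos.
    + apply Cinf_div; [intros r [H _]; lra | apply Cinf_const | apply Cinf_id].
  - simpl; apply Cinf_div; [intros r [H _]; lra | apply Cinf_const | apply Cinf_id].
  - exact (Cinf_const D a).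
Qed.

Lemma is_derive_pressure g F r :
  0 < rho F r -> ex_derive (rho F) r -> ex_derive (A F) r ->
  is_derive (pressure g F) r
    (Derive (A F) r * Rpower (rho F r) g
     + g * pressure g F r / rho F r * Derive (rho F) r).
Proof.
  intros Hr H1 H2; unfold pressure, Rpower.
  auto_derive; [repeat split; auto|]. 
  change (fun x : R => A F x) with (A F); change (fun x : R => rho F x) with (rho F).
  field; lra.
Qed.

Lemma is_derive_bernoulli g F r :
  1 < g -> 0 < rho F r -> ex_derive (U1 F) r -> ex_derive (U2 F) r ->
  ex_derive (rho F) r -> ex_derive (pressure g F) r ->
  is_derive (bernoulli g F) r
    (U1 F r * Derive (U1 F) r + U2 F r * Derive (U2 F) r
     + g / (g - 1) * (Derive (pressure g F) r / rho F r
                      - pressure g F r * Derive (rho F) r / rho F r ^ 2)).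
Proof.
  intros Hg Hr H1 H2 H3 H4; unfold bernoulli.
  assert (g - 1 <> 0) by lra.
  auto_derive; [repeat split; auto; nra|].
  change (fun x : R => U1 F x) with (U1 F); change (fun x : R => U2 F x) with (U2 F).
  change (fun x : R => rho F x) with (rho F).
  change (fun x : R => pressure g F x) with (pressure g F).
  field; split; lra.
Qed.

(** Mass, swirl and entropy equations are read off the formulas.  The momentum
    equation is the derivative of the constant Bernoulli function, since p' / rho
    is the derivative of g p / ((g-1) rho) at constant entropy. *)
Lemma branch_flow_euler g k1 k2 B a P br x y :
  1 < g -> 0 < a -> 0 < k1 -> mach_branch g P br ->
  (forall r, x < r < y -> admissible g k1 k2 B a r) ->
  forall r, x < r < y -> euler g (branch_flow g k1 k2 B a br) r.
Proof.
  intros Hg Ha Hk Hbr Hadm r Hr.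
  assert (Hinv : forall s, x < s < y ->
    invariants g k1 k2 B a (branch_flow g k1 k2 B a br) s).
  { intros s Hs; eapply branch_flow_invariants; eauto. }
  destruct (Cinf_branch_flow g k1 k2 B a P br Hg Ha Hk Hbr) as [S1 [S2 [S3 _]]].
  set (F := branch_flow g k1 k2 B a br) in *.
  assert (D1 : ex_derive (U1 F) r) by (destruct (S1 1%nat) as [f [Hf _]]; eexists; apply Hf; auto).
  assert (D3 : ex_derive (rho F) r) by (destruct (S3 1%nat) as [f [Hf _]]; eexists; apply Hf; auto).
  destruct (Hinv r Hr) as [I1 [I2 [I3 [I4 I5]]]].
  assert (r0 : 0 < r) by apply (Hadm r Hr).
  assert (D2 : is_derive (U2 F) r (- k2 / r ^ 2)).
  { simpl; auto_derive; [lra|]. field; lra. }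
  assert (D4 : is_derive (A F) r 0) by exact (is_derive_const (V := R_NormedModule) a r).
  assert (DP := is_derive_pressure g F r I1 D3 (ex_intro _ _ D4)).
  rewrite (is_derive_unique _ _ _ D4) in DP.
  assert (DB := is_derive_bernoulli g F r Hg I1 D1 (ex_intro _ _ D2) D3 (ex_intro _ _ DP)).
  assert (DB0 : is_derive (bernoulli g F) r 0).
  { apply (is_derive_ext_loc (fun _ => B)); [|apply (is_derive_const (V := R_NormedModule))].
    generalize (locally_interval x y r Hr); apply filter_imp; intros s Hs.
    symmetry; apply (Hinv s Hs). }
  apply is_derive_unique in DB0; rewrite (is_derive_unique _ _ _ DB) in DB0.
  assert (DM : is_derive (fun s => rho F s * U1 F s) r (- k1 / r ^ 2)).
  { apply (is_derive_ext_loc (fun s => k1 / s)); [|auto_derive; [lra | field; lra]].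
    generalize (locally_interval x y r Hr); apply filter_imp; intros s Hs.
    destruct (Hinv s Hs) as [_ [_ [E _]]].
    assert (0 < s) by apply (Hadm s Hs).
    change (k1 / s = rho F s * U1 F s); rewrite <- E; field; lra. }
  assert (EM : Derive (fun s : R => rho F s * U1 F s) r = - k1 / r ^ 2)
    by exact (is_derive_unique _ _ _ DM).
  unfold euler; rewrite EM, (is_derive_unique _ _ _ D2),
    (is_derive_unique _ _ _ D4).
  rewrite (is_derive_unique _ _ _ D2), (is_derive_unique _ _ _ DP) in DB0.
  rewrite (is_derive_unique _ _ _ DP).
  assert (E2 : U2 F r = k2 / r) by reflexivity.
  repeat split.
  - rewrite <- I3; field; lra.
  - eapply eq_trans; [|exact DB0]; rewrite E2; field; lra.
  - rewrite E2; field; lra.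
  - ring.
Qed.

Lemma branch_flow_solution g k1 k2 B a P br x y :
  1 < g -> 0 < a -> 0 < k1 -> mach_branch g P br ->
  (forall r, x <= r <= y -> admissible g k1 k2 B a r) ->
  solution_upto_closure g x y (branch_flow g k1 k2 B a br).
Proof.
  intros Hg Ha Hk Hbr Hadm.
  assert (Hin : forall r, x < r < y -> admissible g k1 k2 B a r)
    by (intros; apply Hadm; lra).
  destruct (Cinf_branch_flow g k1 k2 B a P br Hg Ha Hk Hbr) as [S1 [S2 [S3 [S4 _]]]].
  assert (Hpos : forall r, 0 < rho (branch_flow g k1 k2 B a br) r)
    by (intros; apply Rpower_pos).
  assert (HS : forall f, Cinf (admissible g k1 k2 B a) f ->
     smooth_on (fun r => x < r < y) f /\ continuous_on (fun r => x <= r <= y) f).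
  { intros f Hf; split.
    - apply Cinf_smooth_on; [apply open_interval|].
      intros n; apply (Ck_sub n (admissible g k1 k2 B a)); auto.
    - apply continuous_on_of_continuous; intros r Hr.
      apply (Cinf_continuous (admissible g k1 k2 B a)); auto. }
  destruct (HS _ S1), (HS _ S2), (HS _ S3), (HS _ S4).
  repeat split; auto; try (eapply branch_flow_euler; eauto).
Qed.

(** * Conservation laws for an arbitrary solution *)

Lemma smooth_solution_at g D F r :
  smooth_solution g D F -> D r ->
  ex_derive (U1 F) r /\ ex_derive (U2 F) r /\ ex_derive (rho F) r /\ ex_derive (A F) r
  /\ 0 < rho F r /\ 0 < A F r /\ euler g F r.
Proof.
  intros [S1 [S2 [S3 [S4 S5]]]] Hr.
  repeat split; try apply (S5 r Hr);
    [apply (S1 1%nat r Hr) | apply (S2 1%nat r Hr) | apply (S3 1%nat r Hr) | apply (S4 1%nat r Hr)].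
Qed.

Lemma mass_flux_derivative g F r :
  0 < r -> ex_derive (U1 F) r -> ex_derive (rho F) r -> euler g F r ->
  is_derive (fun s => s * (rho F s * U1 F s)) r 0.
Proof.
  intros Hr D1 D3 [E1 _].
  assert (D : is_derive (fun s : R => rho F s * U1 F s) r (- / r * (rho F r * U1 F r))).
  { replace (- / r * (rho F r * U1 F r)) with (Derive (fun s : R => rho F s * U1 F s) r) by lra.
    now apply Derive_correct, ex_derive_mult. }
  set (Q := fun s : R => rho F s * U1 F s) in *.
  change (rho F r * U1 F r) with (Q r) in D; change (is_derive (fun s => s * Q s) r 0).
  auto_derive; [eexists; exact D|].
  change (fun x : R => Q x) with Q; rewrite (is_derive_unique _ _ _ D); field; lra.
Qed.

Lemma swirl_derivative g F r :
  0 < r -> U1 F r <> 0 -> ex_derive (U2 F) r -> euler g F r ->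
  is_derive (fun s => s * U2 F s) r 0.
Proof.
  intros Hr H1 D2 [_ [_ [E _]]].
  auto_derive; auto. change (fun x : R => U2 F x) with (U2 F).
  apply (Rmult_eq_reg_l (U1 F r / r)).
  - rewrite Rmult_0_r, <- E; field; lra.
  - intros H; apply H1; replace (U1 F r) with (U1 F r / r * r) by (field; lra). rewrite H; ring.
Qed.

Lemma entropy_derivative g F r :
  U1 F r <> 0 -> ex_derive (A F) r -> euler g F r -> is_derive (A F) r 0.
Proof.
  intros H1 D [_ [_ [_ E]]]; apply Rmult_integral in E.
  replace 0 with (Derive (A F) r) by tauto. now apply Derive_correct.
Qed.

Lemma bernoulli_derivative g F r :
  1 < g -> 0 < r -> U1 F r <> 0 -> ex_derive (U1 F) r -> ex_derive (U2 F) r ->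
  ex_derive (rho F) r -> ex_derive (A F) r -> 0 < rho F r -> euler g F r ->
  is_derive (bernoulli g F) r 0.
Proof.
  intros Hg Hr H1 D1 D2 D3 D4 Hp HE.
  assert (DA := entropy_derivative g F r H1 D4 HE).
  assert (DP := is_derive_pressure g F r Hp D3 D4).
  rewrite (is_derive_unique _ _ _ DA) in DP.
  assert (DB := is_derive_bernoulli g F r Hg Hp D1 D2 D3 (ex_intro _ _ DP)).
  destruct HE as [_ [E2 [E3 _]]].
  assert (ES : Derive (U2 F) r = - U2 F r / r).
  { apply (Rmult_eq_reg_l (U1 F r)); auto. rewrite <- (Rplus_0_r (_ * Derive _ _)).
    rewrite <- (Rminus_diag (U1 F r * U2 F r / r)) at 1. 
    replace (U1 F r * (- U2 F r / r)) with (0 - U1 F r * U2 F r / r) by (field; lra).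
    rewrite <- E3; ring. }
  rewrite (is_derive_unique _ _ _ DP) in DB, E2; rewrite ES in DB.
  match type of DB with is_derive _ _ ?l => replace 0 with l end; auto.
  eapply eq_trans; [|exact E2]. field; lra.
Qed.

Lemma clamp_fields g a b F :
  a <= b -> solution_upto_closure g a b F ->
  forall x,
  continuous (fun y => U1 F (clamp a b y)) x
  /\ continuous (fun y => U2 F (clamp a b y)) x
  /\ continuous (fun y => rho F (clamp a b y)) x
  /\ continuous (fun y => A F (clamp a b y)) x
  /\ continuous (clamp a b) x
  /\ 0 < rho F (clamp a b x) /\ 0 < A F (clamp a b x).
Proof.
  intros Hab [_ [C1 [C2 [C3 [C4 C5]]]]] x.
  destruct (C5 (clamp a b x) (clamp_in a b x Hab)).
  do 4 (split; [now apply continuous_clamp_comp|]).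
  split; [|split; auto].
  apply (continuous_clamp_comp a b (fun y => y)); auto.
  apply continuous_on_of_continuous; intros; apply continuous_id.
Qed.

Lemma clamp_mach g a b F :
  1 < g -> a <= b -> solution_upto_closure g a b F ->
  forall x, continuous (fun y => radial_mach g F (clamp a b y)) x.
Proof.
  intros Hg Hab HS x.
  destruct (clamp_fields g a b F Hab HS x) as [C1 [_ [C3 [C4 [_ [H3 H4]]]]]].
  unfold radial_mach, machsq.
  apply continuous_Rmult; [now apply continuous_sq|].
  apply continuous_Rinv_comp; [|apply Rgt_not_eq, csq_pos; auto].
  unfold csq; apply continuous_Rmult; [|now apply continuous_Rpower_l].
  apply continuous_Rmult; [apply continuous_const | auto].
Qed.

(** Each constant of motion has zero derivative inside the interval and is
    continuous up to its ends.  Conservation of r rho U1 comes first, because it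
    makes U1 nonzero and so gives the equations for U2 and A their force. *)
Lemma solution_invariants g k1 k2 B a0 a b F x :
  1 < g -> 0 < a -> a < b -> k1 <> 0 -> solution_upto_closure g a b F ->
  invariants g k1 k2 B a0 F x -> a <= x <= b ->
  forall y, a <= y <= b -> invariants g k1 k2 B a0 F y.
Proof.
  intros Hg Ha Hab Hk HS [I1 [I2 [I3 [I4 I5]]]] Hx.
  assert (HC := clamp_fields g a b F (Rlt_le _ _ Hab) HS).
  assert (HD : forall r, a < r < b -> _)
    by exact (fun r => smooth_solution_at g _ F r (proj1 HS)).
  assert (Q : forall f : R -> R, (forall t, continuous (fun y => f (clamp a b y)) t) ->
     (forall t, a < t < b -> is_derive f t 0) -> forall y, a <= y <= b -> f y = f x).
  { intros f Cf Df y Hy.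
    rewrite (zero_derivative_constant f a b Hab Cf Df y Hy).
    symmetry; apply (zero_derivative_constant f a b Hab Cf Df x Hx). }
  assert (Q1 : forall y, a <= y <= b -> y * (rho F y * U1 F y) = k1).
  { intros y Hy; rewrite <- I3; revert y Hy.
    apply (Q (fun s => s * (rho F s * U1 F s))).
    - intros t; destruct (HC t) as [C1 [C2 [C3 [C4 [C5 _]]]]].
      apply continuous_Rmult; [exact C5 | now apply continuous_Rmult].
    - intros t Ht; apply (mass_flux_derivative g); try apply (HD t Ht). lra. }
  assert (HU : forall y, a <= y <= b -> U1 F y <> 0).
  { intros y Hy E; apply Hk; rewrite <- (Q1 y Hy), E; ring. }
  assert (Q2 : forall y, a <= y <= b -> y * U2 F y = k2).
  { intros y Hy; rewrite <- I4; revert y Hy.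
    apply (Q (fun s => s * U2 F s)).
    - intros t; destruct (HC t) as [C1 [C2 [C3 [C4 [C5 _]]]]].
      now apply continuous_Rmult.
    - intros t Ht; apply (swirl_derivative g); try apply (HD t Ht); [lra|].
      apply HU; lra. }
  assert (Q3 : forall y, a <= y <= b -> A F y = a0).
  { intros y Hy; rewrite <- I2; revert y Hy; apply Q.
    - intros t; apply (HC t).
    - intros t Ht; apply (entropy_derivative g); try apply (HD t Ht). apply HU; lra. }
  assert (Q4 : forall y, a <= y <= b -> bernoulli g F y = B).
  { intros y Hy; rewrite <- I5; revert y Hy; apply Q.
    - intros t; destruct (HC t) as [C1 [C2 [C3 [C4 [C5 [H3 H4]]]]]].
      unfold bernoulli, pressure.
      apply (continuous_plus (V := R_NormedModule)).
      + apply continuous_Rmult; [apply continuous_const|].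
        apply (continuous_plus (V := R_NormedModule)); now apply continuous_sq.
      + apply continuous_Rmult.
        * apply continuous_Rmult; [apply continuous_const|].
          apply continuous_Rmult; [auto | now apply continuous_Rpower_l].
        * apply continuous_Rinv_comp; [|nra].
          apply continuous_Rmult; [apply continuous_const | auto].
    - intros t Ht; apply bernoulli_derivative; auto; try apply (HD t Ht); [lra|].
      apply HU; lra. }
  intros y Hy; repeat split; auto.
  apply HS; auto.
Qed.

Lemma invariants_unique g k1 k2 B a F G r :
  1 < g -> 0 < a -> 0 < k1 -> 0 < r ->
  invariants g k1 k2 B a F r -> invariants g k1 k2 B a G r ->
  0 < (radial_mach g F r - 1) * (radial_mach g G r - 1) ->
  U1 F r = U1 G r /\ U2 F r = U2 G r /\ rho F r = rho G r /\ A F r = A G r.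
Proof.
  intros Hg Ha Hk Hr HF HG HM.
  assert (SF := invariants_state _ _ _ _ _ _ _ Hg Ha Hk Hr HF).
  assert (SG := invariants_state _ _ _ _ _ _ _ Hg Ha Hk Hr HG).
  destruct HF as [_ [F2 [_ [F4 _]]]], HG as [_ [G2 [_ [G4 _]]]].
  unfold radial_mach in HM; rewrite F2, G2 in HM.
  destruct (state_unique _ _ _ _ _ _ _ _ Hg SF SG HM) as [E1 E2].
  repeat split; auto; [|congruence].
  apply (Rmult_eq_reg_l r); lra.
Qed.

Lemma invariants_mach g k1 k2 B a F r :
  1 < g -> 0 < a -> 0 < k1 -> 0 < r -> invariants g k1 k2 B a F r ->
  0 < radial_mach g F r /\ mach_fn g (radial_mach g F r) = flow_level g k1 k2 B a r.
Proof.
  intros Hg Ha Hk Hr HF.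
  assert (SF := invariants_state _ _ _ _ _ _ _ Hg Ha Hk Hr HF).
  destruct HF as [_ [F2 _]]; unfold radial_mach; rewrite F2; split.
  - apply machsq_pos; auto; apply SF.
  - apply (state_mach g _ _ _ _ _ Hg SF).
Qed.

(** M = 1 would put the level at its sonic value, so a continuous M remains on
    one side of 1. *)
Lemma solution_stays_on_branch g k1 k2 B a0 a b F :
  1 < g -> 0 < a -> a < b -> 0 < k1 -> 0 < a0 -> solution_upto_closure g a b F ->
  (forall y, a <= y <= b -> invariants g k1 k2 B a0 F y) ->
  (forall y, a <= y <= b -> flow_level g k1 k2 B a0 y < mach_fn g 1) ->
  forall x y, a <= x <= b -> a <= y <= b ->
  0 < (radial_mach g F x - 1) * (radial_mach g F y - 1).
Proof.
  intros Hg Ha Hab Hk Ha0 HS HI HL.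
  assert (Hne : forall y, a <= y <= b -> radial_mach g F y <> 1).
  { intros y Hy E; assert (0 < y) by lra.
    destruct (invariants_mach _ _ _ _ _ F y Hg Ha0 Hk H (HI y Hy)) as [_ H2].
    specialize (HL y Hy); rewrite <- H2, E in HL; lra. }
  assert (HC := clamp_mach g a b F Hg (Rlt_le _ _ Hab) HS).
  assert (HV := avoided_value_same_side _ a b 1 (Rlt_le _ _ Hab) HC Hne).
  intros x y Hx Hy; assert (X := Hne x Hx); assert (Y := Hne y Hy).
  assert (XY := HV x y Hx Hy); assert (YX := HV y x Hy Hx).
  destruct (Rlt_le_dec (radial_mach g F x) 1) as [L|L].
  - specialize (XY L); nra.
  - destruct (Rlt_le_dec (radial_mach g F y) 1) as [L'|L']; [specialize (YX L'); lra|].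
    apply Rmult_lt_0_compat; lra.
Qed.

(** * Supersonic, sonic and subsonic regimes *)

(** The common value of c^2 and of the squared speed at a sonic point of a flow
    with Bernoulli constant B. *)
Definition critical_csq (g B : R) : R := 2 * (g - 1) / (g + 1) * B.

Lemma sound_sq g F r :
  1 < g -> 0 < rho F r -> 0 < A F r -> sound g F r ^ 2 = csq g (A F r) (rho F r).
Proof.
  intros Hg H1 H2; unfold sound; rewrite pressure_over_rho by auto.
  apply pow2_sqrt, Rlt_le, csq_pos; auto.
Qed.

Lemma sound_lt_U1 g F r :
  1 < g -> 0 < rho F r -> 0 < A F r -> 0 < U1 F r ->
  (sound g F r < U1 F r <-> 1 < radial_mach g F r).
Proof.
  intros Hg H1 H2 H3; unfold radial_mach; rewrite machsq_gt_1 by auto.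
  rewrite <- sound_sq by auto.
  assert (0 <= sound g F r) by apply sqrt_pos. split; nra.
Qed.

Lemma U1_lt_sound g F r :
  1 < g -> 0 < rho F r -> 0 < A F r -> 0 < U1 F r ->
  (U1 F r < sound g F r <-> radial_mach g F r < 1).
Proof.
  intros Hg H1 H2 H3; unfold radial_mach; rewrite machsq_lt_1 by auto.
  rewrite <- sound_sq by auto.
  assert (0 <= sound g F r) by apply sqrt_pos. split; nra.
Qed.

(** The squared speed is 2 B - 2 c^2 / (g-1) by the Bernoulli equation, so that
    c^2 alone decides the regime. *)
Lemma speed_excess g B F r :
  1 < g -> 0 < rho F r -> 0 < A F r -> bernoulli g F r = B ->
  U1 F r ^ 2 + U2 F r ^ 2 - sound g F r ^ 2
  = (g + 1) / (g - 1) * (critical_csq g B - csq g (A F r) (rho F r)).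
Proof.
  intros Hg H1 H2 <-; rewrite sound_sq, bernoulli_csq by auto.
  unfold critical_csq; field; lra.
Qed.

Lemma speed_regimes g B F r :
  1 < g -> 0 < rho F r -> 0 < A F r -> bernoulli g F r = B ->
  let a := csq g (A F r) (rho F r) in
  (a < critical_csq g B -> supersonic g F r)
  /\ (a = critical_csq g B -> sonic g F r)
  /\ (critical_csq g B < a -> subsonic g F r).
Proof.
  intros Hg H1 H2 HB a; assert (E := speed_excess g B F r Hg H1 H2 HB); fold a in E.
  assert (0 < (g + 1) / (g - 1)) by (apply Rdiv_lt_0_compat; lra).
  unfold supersonic, sonic, subsonic; repeat split; intros; nra.
Qed.

Lemma radially_supersonic_supersonic g F r :
  1 < g -> 0 < rho F r -> 0 < A F r -> 1 < radial_mach g F r -> supersonic g F r.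
Proof.
  intros Hg H1 H2 H; unfold supersonic; rewrite sound_sq by auto.
  apply machsq_gt_1 in H; auto. nra.
Qed.

(** The function f1, with the radius and the radial Mach number as independent
    variables: the denominator in f1 is [prandtl] of the radial energy. *)
Definition shock_fn (g k2 B r M : R) : R :=
  (1 - (k2 / r) ^ 2 / prandtl g (radial_energy B k2 r)) * M.

(** The first factor increases with r because the swirl decreases and the radial
    energy increases.  Where the product is positive so is this factor, and the
    two increases multiply. *)
Lemma shock_fn_increasing g k2 B r s M N :
  1 < g -> 0 < r -> r < s -> 0 < radial_energy B k2 r -> 0 < M -> M < N ->
  0 < shock_fn g k2 B r M -> shock_fn g k2 B r M < shock_fn g k2 B s N.
Proof.
  intros Hg Hr Hs HE HM HN; unfold shock_fn.
  set (X := 1 - (k2 / r) ^ 2 / prandtl g (radial_energy B k2 r)).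
  set (Y := 1 - (k2 / s) ^ 2 / prandtl g (radial_energy B k2 s)).
  intros H0.
  assert (HX : 0 < X).
  { apply (Rmult_lt_reg_r M); lra. }
  assert (HXY : X <= Y).
  { assert (HEs : radial_energy B k2 r <= radial_energy B k2 s)
      by (apply radial_energy_increasing; lra).
    assert (W := prandtl_pos g _ Hg HE).
    assert (WW : prandtl g (radial_energy B k2 r) <= prandtl g (radial_energy B k2 s)).
    { unfold prandtl; apply Rmult_le_compat_l; auto.
      apply Rlt_le, Rdiv_lt_0_compat; lra. }
    apply Rplus_le_compat_l, Ropp_le_contravar.
    apply Rmult_le_compat; [nra | apply Rlt_le, Rinv_0_lt_compat; lra | |
      apply Rinv_le_contravar; lra].
    replace ((k2 / s) ^ 2) with (k2 ^ 2 * / s ^ 2) by (field; lra).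
    replace ((k2 / r) ^ 2) with (k2 ^ 2 * / r ^ 2) by (field; lra).
    apply Rmult_le_compat_l; [nra|]. apply Rinv_le_contravar; nra. }
  nra.
Qed.

(** * The flow ahead of and behind a shock at a given radius *)

Section RadialShock.

Variables (g r0 r1 : R) (I : inflow) (bp bs : R -> R).
Hypotheses (hg : 1 < g) (hr0 : 0 < r0).
Hypotheses (hrho : 0 < rho0 I) (hA : 0 < A0 I) (hU1 : 0 < U10 I).
Hypothesis hsup : U10 I ^ 2 > g * A0 I * Rpower (rho0 I) (g - 1).
Hypothesis hp : mach_branch g (fun M => 1 < M) bp.
Hypothesis hs : mach_branch g (fun M => M < 1) bs.

Local Notation k1 := (kappa1 r0 I).
Local Notation k2 := (kappa2 r0 I).
Local Notation B := (B0 g I).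
Local Notation a0 := (A0 I).

Definition ahead_mach (r : R) : R := bp (flow_level g k1 k2 B a0 r).

Definition entropy_behind (r : R) : R := a0 * entropy_jump g (jump g (ahead_mach r)).

Definition ahead : flow := branch_flow g k1 k2 B a0 bp.

Definition behind (r : R) : flow := branch_flow g k1 k2 B (entropy_behind r) bs.

Definition exit_pressure (r : R) : R := pressure g (behind r) r1.

Lemma k1_pos : 0 < k1.
Proof. unfold kappa1; repeat apply Rmult_lt_0_compat; auto. Qed.

Lemma inflow_invariants F : has_data r0 I F -> invariants g k1 k2 B a0 F r0.
Proof.
  intros [D1 [D2 [D3 D4]]]; unfold invariants, kappa1, kappa2, B0.
  rewrite D1, D2, D3, D4; repeat split; auto; [ring|].
  rewrite bernoulli_csq by (rewrite ?D1; auto); rewrite D1, D2, D3, D4.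
  unfold csq; field; lra.
Qed.

Lemma inflow_mach F : has_data r0 I F -> 1 < radial_mach g F r0.
Proof.
  intros [D1 [D2 [D3 D4]]]; unfold radial_mach; rewrite D1, D2, D4.
  apply machsq_gt_1; auto.
Qed.

(** Reads the inflow data as the values of a flow at r0, so that what holds for
    flows at a single radius applies to them. *)
Definition inflow_flow : flow :=
  Flow (fun _ => U10 I) (fun _ => U20 I) (fun _ => rho0 I) (fun _ => A0 I).

Lemma inflow_flow_data : has_data r0 I inflow_flow.
Proof. repeat split. Qed.

Lemma inflow_admissible : admissible g k1 k2 B a0 r0.
Proof.
  assert (HI := inflow_invariants _ inflow_flow_data).
  assert (HM := inflow_mach _ inflow_flow_data).
  destruct (invariants_mach _ _ _ _ _ _ _ hg hA k1_pos hr0 HI) as [M0 M1].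
  split; [auto|split].
  - exact (state_energy_pos _ _ _ _ _ _ hg
      (invariants_state _ _ _ _ _ _ _ hg hA k1_pos hr0 HI)).
  - rewrite <- M1; apply mach_fn_lt_sonic; auto; lra.
Qed.

Lemma admissible_outwards a r s :
  admissible g k1 k2 B a r -> r <= s -> admissible g k1 k2 B a s.
Proof.
  intros [H1 [H2 H3]] [Hs|<-]; [|repeat split; auto].
  split; [lra|split].
  - eapply Rlt_le_trans; [exact H2|]. apply radial_energy_increasing; lra.
  - eapply Rlt_trans; [|exact H3]. apply flow_level_decreasing; auto using k1_pos.
Qed.

Lemma ahead_admissible r : r0 <= r -> admissible g k1 k2 B a0 r.
Proof. apply admissible_outwards, inflow_admissible. Qed.

Lemma ahead_mach_gt_1 r : admissible g k1 k2 B a0 r -> 1 < ahead_mach r.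
Proof. intros [_ [_ H]]; apply hp, H. Qed.

Lemma ahead_mach_increasing r s :
  admissible g k1 k2 B a0 r -> r < s -> ahead_mach r < ahead_mach s.
Proof.
  intros [H1 [H2 H3]] Hs; unfold ahead_mach.
  apply (supersonic_branch_decreasing g); auto.
  apply flow_level_decreasing; auto using k1_pos.
Qed.

Lemma entropy_behind_pos r : r0 <= r -> 0 < entropy_behind r.
Proof.
  intros Hr; assert (M1 := ahead_mach_gt_1 _ (ahead_admissible r Hr)).
  destruct (jump_bounds g _ hg M1).
  apply Rmult_lt_0_compat; auto. apply entropy_jump_pos; lra.
Qed.

Lemma entropy_behind_increasing r s :
  r0 <= r -> r < s -> entropy_behind r < entropy_behind s.
Proof.
  intros Hr Hs; assert (Hs0 : r0 <= s) by lra.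
  assert (M1 := ahead_mach_gt_1 _ (ahead_admissible r Hr)).
  assert (M2 := ahead_mach_gt_1 _ (ahead_admissible s Hs0)).
  assert (M3 := ahead_mach_increasing _ _ (ahead_admissible r Hr) Hs).
  destruct (jump_bounds g _ hg M1), (jump_bounds g _ hg M2).
  apply Rmult_lt_compat_l; auto. apply entropy_jump_increasing; try lra.
  apply jump_increasing; lra.
Qed.

Lemma ahead_state r :
  r0 <= r ->
  radial_state g (k1 / r) (radial_energy B k2 r) a0 (rho ahead r) (U1 ahead r)
  /\ radial_mach g ahead r = ahead_mach r.
Proof.
  intros Hr.
  destruct (branch_flow_state g k1 k2 B a0 _ bp r hg hA k1_pos hp (ahead_admissible r Hr))
    as [H1 [H2 _]]; split; auto.
Qed.

Lemma ahead_invariants r : r0 <= r -> invariants g k1 k2 B a0 ahead r.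
Proof.
  intros Hr; eapply branch_flow_invariants; eauto using k1_pos, ahead_admissible.
Qed.

Lemma behind_shock_state r :
  r0 <= r ->
  let x := jump g (ahead_mach r) in
  radial_state g (k1 / r) (radial_energy B k2 r) (entropy_behind r)
    (rho ahead r * x) (U1 ahead r / x)
  /\ machsq g (entropy_behind r) (rho ahead r * x) (U1 ahead r / x) < 1
  /\ momentum g (entropy_behind r) (rho ahead r * x) (U1 ahead r / x)
     = momentum g a0 (rho ahead r) (U1 ahead r)
  /\ a0 * Rpower (rho ahead r) g < entropy_behind r * Rpower (rho ahead r * x) g.
Proof.
  intros Hr; destruct (ahead_state r Hr) as [S HM].
  assert (M1 := ahead_mach_gt_1 _ (ahead_admissible r Hr)).
  unfold entropy_behind; rewrite <- HM; apply shock_behind; auto.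
  change (1 < radial_mach g ahead r); lra.
Qed.

(** The state just behind the shock is radially subsonic, so its level lies
    below the sonic one, and the level decreases outwards. *)
Lemma behind_admissible r s :
  r0 <= r -> r <= s -> admissible g k1 k2 B (entropy_behind r) s.
Proof.
  intros Hr Hs; apply (admissible_outwards _ r); auto.
  destruct (behind_shock_state r Hr) as [S [HM _]].
  destruct (ahead_admissible r Hr) as [H1 [H2 _]]; split; [auto|split; auto].
  unfold flow_level; rewrite <- (state_mach _ _ _ _ _ _ hg S).
  apply mach_fn_lt_sonic; auto; [|lra]. apply machsq_pos; auto; apply S.
Qed.

Lemma behind_state r s :
  r0 <= r -> r <= s ->
  radial_state g (k1 / s) (radial_energy B k2 s) (entropy_behind r)
    (rho (behind r) s) (U1 (behind r) s)
  /\ radial_mach g (behind r) s = bs (flow_level g k1 k2 B (entropy_behind r) s)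
  /\ radial_mach g (behind r) s < 1
  /\ csq g (entropy_behind r) (rho (behind r) s)
     = csq_of g (radial_energy B k2 s) (radial_mach g (behind r) s).
Proof.
  intros Hr Hs.
  destruct (branch_flow_state g k1 k2 B (entropy_behind r) _ bs s hg
    (entropy_behind_pos r Hr) k1_pos hs (behind_admissible r s Hr Hs))
    as [H1 [H2 H3]].
  fold (behind r) in *; split; auto; split; auto; rewrite H2; split; auto.
  apply hs, (behind_admissible r s Hr Hs).
Qed.

Lemma behind_invariants r s :
  r0 <= r -> r <= s -> invariants g k1 k2 B (entropy_behind r) (behind r) s.
Proof.
  intros Hr Hs.
  eapply branch_flow_invariants; eauto using k1_pos, behind_admissible, entropy_behind_pos.
Qed.

(** [behind] was built from the entropy alone; its state at the shock is the
    one given by the shock relations because both are radially subsonic with the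
    same constants. *)
Lemma behind_at_shock r :
  r0 <= r ->
  rho (behind r) r = rho ahead r * jump g (ahead_mach r)
  /\ U1 (behind r) r = U1 ahead r / jump g (ahead_mach r).
Proof.
  intros Hr; destruct (behind_shock_state r Hr) as [S [HM _]].
  destruct (behind_state r r Hr (Rle_refl r)) as [S' [_ [HM' _]]].
  change (machsq g (entropy_behind r) (rho (behind r) r) (U1 (behind r) r) < 1) in HM'.
  apply (state_unique _ _ _ _ _ _ _ _ hg S' S).
  nra.
Qed.

Lemma behind_rankine_hugoniot r :
  r0 <= r ->
  rankine_hugoniot g ahead (behind r) r
  /\ pressure g (behind r) r > pressure g ahead r.
Proof.
  intros Hr; destruct (behind_shock_state r Hr) as [S [_ [HM HP]]].
  destruct (ahead_state r Hr) as [SA _].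
  destruct (behind_at_shock r Hr) as [E1 E2].
  destruct S as [_ [_ [_ [Em _]]]], SA as [_ [_ [_ [Em' _]]]].
  assert (IA := ahead_invariants r Hr).
  assert (IB := behind_invariants r r Hr (Rle_refl r)).
  rewrite <- E1, <- E2 in *.
  assert (Emm : rho (behind r) r * U1 (behind r) r = rho ahead r * U1 ahead r) by congruence.
  split; [|exact HP].
  split; [exact Emm|split; [exact HM|split]].
  - rewrite Emm; reflexivity.
  - destruct IA as [_ [_ [_ [_ ->]]]]; apply IB.
Qed.

Lemma exit_pressure_eq r :
  r0 <= r -> r <= r1 ->
  exit_pressure r = pressure_of g (k1 / r1) (radial_energy B k2 r1)
    (bs (flow_level g k1 k2 B (entropy_behind r) r1)).
Proof.
  intros Hr Hr'; destruct (behind_state r r1 Hr Hr') as [S [EM _]].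
  rewrite <- EM; unfold exit_pressure, radial_mach.
  exact (state_pressure _ _ _ _ _ _ hg S).
Qed.

(** A larger shock radius means a larger entropy behind, a higher level at r1, a
    larger subsonic Mach number and a smaller pressure. *)
Lemma exit_pressure_decreasing r s :
  r0 <= r -> r < s -> s <= r1 -> exit_pressure s < exit_pressure r.
Proof.
  intros Hr Hs Hs1; rewrite !exit_pressure_eq by lra.
  assert (A1 := behind_admissible r r1 Hr ltac:(lra)).
  assert (A2 := behind_admissible s r1 ltac:(lra) Hs1).
  apply pressure_of_decreasing; auto.
  - apply Rdiv_lt_0_compat; [apply k1_pos | lra].
  - apply A1.
  - apply hs, A1.
  - apply (subsonic_branch_increasing g); auto; [|apply A2].
    apply flow_level_entropy; auto using entropy_behind_pos, entropy_behind_increasing.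
Qed.

Lemma Cinf_entropy_behind : Cinf (fun r => r0 <= r) entropy_behind.
Proof.
  assert (HM : Cinf (fun r => r0 <= r) ahead_mach).
  { intros n; apply (Ck_sub n (admissible g k1 k2 B a0)); [exact ahead_admissible|].
    exact (proj2 (proj2 (proj2 (proj2
      (Cinf_branch_flow g k1 k2 B a0 _ bp hg hA k1_pos hp)))) n). }
  assert (HX : Cinf (fun r => r0 <= r) (fun r => jump g (ahead_mach r))).
  { unfold jump; apply Cinf_div.
    - intros r Hr; assert (M1 := ahead_mach_gt_1 _ (ahead_admissible r Hr)); nra.
    - apply Cinf_mult; [apply Cinf_const | exact HM].
    - apply Cinf_plus; [|apply Cinf_const].
      apply Cinf_mult; [apply Cinf_const | exact HM]. }
  assert (HB : forall r, r0 <= r ->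
    1 < jump g (ahead_mach r) /\ (g - 1) * jump g (ahead_mach r) < g + 1).
  { intros r Hr; apply jump_bounds; auto. apply ahead_mach_gt_1, ahead_admissible, Hr. }
  unfold entropy_behind, entropy_jump, Rpower.
  apply Cinf_mult; [apply Cinf_const|]. apply Cinf_mult.
  - apply Cinf_div.
    + intros r Hr; destruct (HB r Hr); lra.
    + apply Cinf_minus; [|apply Cinf_const].
      apply Cinf_mult; [apply Cinf_const | exact HX].
    + apply Cinf_minus; [apply Cinf_const|].
      apply Cinf_mult; [apply Cinf_const | exact HX].
  - apply Cinf_exp, Cinf_mult; [apply Cinf_const|]. apply Cinf_ln; auto.
    intros r Hr; destruct (HB r Hr); lra.
Qed.

Lemma exit_pressure_continuous r : r0 <= r <= r1 -> continuous exit_pressure r.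
Proof.
  set (D := fun r => r0 <= r <= r1); intros Hr.
  assert (HA' : Cinf D entropy_behind).
  { intros n; apply (Ck_sub n (fun r => r0 <= r)); [now intros x [H _]|].
    apply Cinf_entropy_behind. }
  assert (Hadm : forall x, D x -> admissible g k1 k2 B (entropy_behind x) r1).
  { intros x Hx; apply behind_admissible; apply Hx. }
  assert (Hpos : forall x, D x -> 0 < g * entropy_behind x).
  { intros x Hx; apply Rmult_lt_0_compat; [lra | apply entropy_behind_pos, Hx]. }
  assert (HM : Cinf D (fun x => bs (flow_level g k1 k2 B (entropy_behind x) r1))).
  { apply (Cinf_comp D (fun z => z < mach_fn g 1) bs); [|apply hs|].
    - intros x Hx; apply Hadm, Hx.
    - unfold flow_level, mach_level; apply Cinf_plus; [apply Cinf_const|].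
      apply Cinf_mult; [apply Cinf_const|]. apply Cinf_ln; auto.
      apply Cinf_mult; [apply Cinf_const | exact HA']. }
  assert (HR : Cinf D (fun x => rho (behind x) r1)).
  { simpl; unfold rho_of, Rpower, csq_of.
    assert (HP : forall x, D x ->
      0 < (g - 1) * bs (flow_level g k1 k2 B (entropy_behind x) r1) + 2).
    { intros x Hx; assert (0 < bs (flow_level g k1 k2 B (entropy_behind x) r1))
        by (apply hs, Hadm, Hx). nra. }
    apply Cinf_exp, Cinf_mult; [apply Cinf_const|]. apply Cinf_ln.
    - intros x Hx; apply Rdiv_lt_0_compat; [|now apply Hpos].
      apply Rdiv_lt_0_compat; [|now apply HP].
      apply Rmult_lt_0_compat; [lra | apply (Hadm x Hx)].
    - apply Cinf_div; [intros x Hx; specialize (Hpos x Hx); lra | |].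
      + apply Cinf_div; [intros x Hx E; specialize (HP x Hx); lra | apply Cinf_const|].
        apply Cinf_plus; [|apply Cinf_const].
        apply Cinf_mult; [apply Cinf_const | exact HM].
      + apply Cinf_mult; [apply Cinf_const | exact HA']. }
  apply (Cinf_continuous D); auto.
  unfold exit_pressure, pressure, Rpower.
  apply Cinf_mult; [exact HA'|].
  apply Cinf_exp, Cinf_mult; [apply Cinf_const|].
  apply Cinf_ln; auto. intros x _; apply Rpower_pos.
Qed.

Lemma shock_solution_exists r :
  r0 < r < r1 -> shock_solution g r0 r1 I (exit_pressure r) r ahead (behind r).
Proof.
  intros Hr; assert (Hr0 : r0 <= r) by lra.
  destruct (behind_rankine_hugoniot r Hr0) as [RH HP].
  split; [|split].
  - split; [auto|]; split; [|split; [|split; [auto|split; [auto|split; [|reflexivity]]]]].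
    + eapply branch_flow_solution; eauto using k1_pos.
      intros s Hs; apply ahead_admissible; lra.
    + eapply branch_flow_solution; eauto using k1_pos, entropy_behind_pos.
      intros s Hs; apply behind_admissible; lra.
    + assert (IA := ahead_invariants r0 (Rle_refl r0)).
      assert (I0 := inflow_invariants _ inflow_flow_data).
      assert (M0 := inflow_mach _ inflow_flow_data).
      destruct (ahead_state r0 (Rle_refl r0)) as [_ EM].
      assert (M1 := ahead_mach_gt_1 _ inflow_admissible).
      destruct (invariants_unique _ _ _ _ _ _ _ _ hg hA k1_pos hr0 IA I0) as [E1 [E2 [E3 E4]]].
      { rewrite EM; nra. }
      repeat split; auto.
  - intros s Hs; assert (Hs0 : r0 <= s) by lra.
    destruct (ahead_state s Hs0) as [S EM].
    apply Rlt_gt, sound_lt_U1; auto; try apply S.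
    rewrite EM; apply ahead_mach_gt_1, ahead_admissible; lra.
  - intros s Hs; destruct (behind_state r s Hr0 ltac:(lra)) as [S [_ [EM _]]].
    apply U1_lt_sound; auto; apply S.
Qed.

(** The flow ahead starts on the supersonic branch and cannot leave it.  The
    shock relations with a pressure rise then determine entropy and Mach number
    behind, so that the flow behind lies on the subsonic branch of the entropy
    [entropy_behind s]. *)
Lemma shock_solution_unique pex s Gm Gp :
  shock_solution g r0 r1 I pex s Gm Gp ->
  r0 < s < r1 /\ exit_pressure s = pex
  /\ flow_eq_on r0 s Gm ahead /\ flow_eq_on s r1 Gp (behind s).
Proof.
  intros [[Hs [HGm [HGp [HRH [HP [HD HE]]]]]] _].
  assert (Hs0 : r0 <= s) by lra.
  assert (IGm : forall y, r0 <= y <= s -> invariants g k1 k2 B a0 Gm y).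
  { apply (solution_invariants g k1 k2 B a0 r0 s Gm r0); auto; try lra.
    - apply Rgt_not_eq, k1_pos.
    - now apply inflow_invariants. }
  assert (MGm : forall y, r0 <= y <= s -> 1 < radial_mach g Gm y).
  { intros y Hy; assert (M0 := inflow_mach _ HD).
    assert (0 < (radial_mach g Gm r0 - 1) * (radial_mach g Gm y - 1)); [|nra].
    apply (solution_stays_on_branch g k1 k2 B a0 r0 s); auto using k1_pos; try lra.
    intros z Hz; apply ahead_admissible; lra. }
  assert (Em : flow_eq_on r0 s Gm ahead).
  { intros y Hy; apply (invariants_unique g k1 k2 B a0); auto using k1_pos; try lra.
    - apply ahead_invariants; lra.
    - destruct (ahead_state y) as [_ ->]; [lra|].
      assert (M1 := MGm y Hy); assert (M2 := ahead_mach_gt_1 _ (ahead_admissible y ltac:(lra))).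
      nra. }
  assert (HC := HGp); destruct HC as [_ [_ [_ [_ [_ HC]]]]].
  destruct (HC s) as [Rp Ap]; [lra|].
  assert (HE1 := Em s ltac:(lra)); destruct HE1 as [E1 [E2 [E3 E4]]].
  assert (HIm := IGm s ltac:(lra)).
  destruct HRH as [R1 [R2 [R3 R4]]].
  assert (SA := ahead_state s Hs0); destruct SA as [SA EMA].
  assert (Hmass : 0 < rho Gm s * U1 Gm s).
  { rewrite E1, E3; destruct SA as [_ [H1 [H2 _]]]; now apply Rmult_lt_0_compat. }
  assert (IGs : invariants g k1 k2 B (A Gp s) Gp s).
  { destruct HIm as [I1 [I2 [I3 [I4 I5]]]]; split; [auto|split; [auto|]].
    rewrite R1; repeat split; auto; [|congruence].
    rewrite <- I4; apply (f_equal (Rmult s)); rewrite R1 in R3.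
    apply (Rmult_eq_reg_l (rho Gm s * U1 Gm s)); lra. }
  assert (Hs1 : 0 < s) by lra.
  assert (SGp := invariants_state _ _ _ _ _ _ _ hg Ap k1_pos Hs1 IGs).
  assert (HJ : 1 < machsq g a0 (rho ahead s) (U1 ahead s)).
  { change (1 < radial_mach g ahead s); rewrite EMA.
    now apply ahead_mach_gt_1, ahead_admissible. }
  destruct (shock_unique _ _ _ _ _ _ _ _ _ hg SA HJ SGp) as [X1 [X2 X3]].
  { unfold momentum; rewrite <- E1, <- E3. unfold pressure in R2.
    rewrite E4 in R2; exact R2. }
  { unfold pressure in HP; rewrite E3, E4 in HP; exact HP. }
  change (machsq g a0 (rho ahead s) (U1 ahead s)) with (radial_mach g ahead s) in *.
  rewrite EMA in *; fold (entropy_behind s) in X3.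
  assert (HAp := entropy_behind_pos s Hs0).
  rewrite X3 in IGs.
  assert (IGp : forall y, s <= y <= r1 -> invariants g k1 k2 B (entropy_behind s) Gp y).
  { apply (solution_invariants g k1 k2 B _ s r1 Gp s); auto; try lra.
    apply Rgt_not_eq, k1_pos. }
  assert (MGs : radial_mach g Gp s < 1).
  { destruct (behind_shock_state s Hs0) as [_ [H _]].
    unfold radial_mach; now rewrite X1, X2, X3. }
  assert (Ep : flow_eq_on s r1 Gp (behind s)).
  { intros y Hy; apply (invariants_unique g k1 k2 B (entropy_behind s)); auto using k1_pos; try lra.
    - apply behind_invariants; lra.
    - destruct (behind_state s y Hs0) as [_ [_ [M2 _]]]; [lra|].
      assert (0 < (radial_mach g Gp s - 1) * (radial_mach g Gp y - 1)); [|nra].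
      apply (solution_stays_on_branch g k1 k2 B (entropy_behind s) s r1); auto using k1_pos; try lra.
      intros z Hz; apply behind_admissible; lra. }
  repeat split; try lra; auto; try (now apply Em); try now apply Ep.
  rewrite <- HE; unfold exit_pressure, pressure.
  destruct (Ep r1) as [_ [_ [-> ->]]]; [lra | reflexivity].
Qed.

(** * The sonic pattern behind the shock *)

Definition behind_csq (r s : R) : R := csq g (entropy_behind r) (rho (behind r) s).

(** By the energy equation c^2 increases with the radial energy and decreases
    with M, and on the subsonic branch M decreases outwards. *)
Lemma behind_csq_increasing r s t :
  r0 <= r -> r <= s -> s < t -> behind_csq r s < behind_csq r t.
Proof.
  intros Hr Hs Ht; unfold behind_csq.
  assert (Hrt : r <= t) by lra.
  destruct (behind_state r s Hr Hs) as [S [EM [HM ->]]].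
  destruct (behind_state r t Hr Hrt) as [S' [EM' [HM' ->]]].
  assert (A1 := behind_admissible r s Hr Hs).
  assert (A2 := behind_admissible r t Hr Hrt).
  rewrite EM, EM'; unfold csq_of.
  set (z := flow_level g k1 k2 B (entropy_behind r) s) in *.
  set (w := flow_level g k1 k2 B (entropy_behind r) t) in *.
  assert (HL : w < z).
  { apply flow_level_decreasing; auto using k1_pos; [lra | apply A1]. }
  assert (HB : bs w < bs z) by (apply (subsonic_branch_increasing g); auto; apply A1).
  assert (W0 : 0 < bs w) by (apply hs, A2).
  assert (HE : radial_energy B k2 s <= radial_energy B k2 t)
    by (apply radial_energy_increasing; lra).
  assert (E0 : 0 < radial_energy B k2 s) by apply A1.
  assert (H1 : 0 < (g - 1) * (bs z - bs w)) by (apply Rmult_lt_0_compat; lra).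
  assert (H2 : 0 < (g - 1) * bs w) by (apply Rmult_lt_0_compat; lra).
  apply (Rlt_le_trans _ (2 * (g - 1) * radial_energy B k2 s / ((g - 1) * bs w + 2))).
  - apply Rmult_lt_compat_l; [apply Rmult_lt_0_compat; lra|].
    apply Rinv_lt_contravar; [apply Rmult_lt_0_compat|]; lra.
  - apply Rmult_le_compat_r; [apply Rlt_le, Rinv_0_lt_compat; lra|].
    apply Rmult_le_compat_l; lra.
Qed.

Lemma behind_regime r s :
  r0 <= r -> r <= s ->
  (behind_csq r s < critical_csq g B -> supersonic g (behind r) s)
  /\ (behind_csq r s = critical_csq g B -> sonic g (behind r) s)
  /\ (critical_csq g B < behind_csq r s -> subsonic g (behind r) s).
Proof.
  intros Hr Hs; destruct (behind_invariants r s Hr Hs) as [I1 [I2 [_ [_ I5]]]].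
  unfold behind_csq; rewrite <- I2.
  apply speed_regimes; auto. rewrite I2; now apply entropy_behind_pos.
Qed.

Lemma behind_csq_continuous r s :
  r0 <= r -> r <= s -> continuous (behind_csq r) s.
Proof.
  intros Hr Hs; unfold behind_csq, csq.
  apply continuous_Rmult; [apply continuous_const|].
  apply continuous_Rpower_l; [|apply (behind_state r s Hr Hs)].
  destruct (Cinf_branch_flow g k1 k2 B (entropy_behind r) _ bs hg
    (entropy_behind_pos r Hr) k1_pos hs) as [_ [_ [HC _]]].
  apply (Cinf_continuous _ _ _ HC), behind_admissible; auto.
Qed.

(** With w the Prandtl product, u the upstream velocity and q = U2, both sides
    equal (g-1)/(g+1) ((g+1)/2 (w - w^2 / u^2) - q^2). *)
Lemma csq_at_shock r :
  r0 <= r ->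
  behind_csq r r - critical_csq g B
  = (g - 1) / (g + 1) * (prandtl g (radial_energy B k2 r) / ahead_mach r)
    * (shock_fn g k2 B r (ahead_mach r) - 1).
Proof.
  intros Hr.
  destruct (behind_shock_state r Hr) as [S [_ _]].
  destruct (behind_at_shock r Hr) as [E1 E2].
  destruct (ahead_state r Hr) as [SA EM].
  rewrite <- E1, <- E2 in S.
  assert (C1 := state_csq_prandtl _ _ _ _ _ _ hg S).
  assert (C2 := state_csq_prandtl _ _ _ _ _ _ hg SA).
  assert (J := jump_prandtl _ _ _ _ _ _ hg SA).
  assert (W := prandtl_pos g _ hg (state_energy_pos _ _ _ _ _ _ hg SA)).
  change (machsq g a0 (rho ahead r) (U1 ahead r)) with (radial_mach g ahead r) in J.
  assert (EM' : ahead_mach r = U1 ahead r ^ 2 / csq g a0 (rho ahead r)) by now rewrite <- EM.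
  assert (C := csq_pos g a0 (rho ahead r) hg hA).
  rewrite E2, <- EM, J in C1; unfold behind_csq; rewrite C1.
  unfold shock_fn; rewrite EM'.
  assert (Kc : critical_csq g B
    = prandtl g (radial_energy B k2 r) + (g - 1) / (g + 1) * (k2 / r) ^ 2).
  { unfold critical_csq, prandtl, radial_energy; field; lra. }
  rewrite Kc; set (w := prandtl g (radial_energy B k2 r)) in *.
  set (u := U1 ahead r) in *; set (q := k2 / r).
  assert (Hu : 0 < u) by apply SA.
  rewrite C2 in *. clear - hg W C Hu. clearbody w q u.
  field; repeat split; nra.
Qed.

(** With R, u, a the density, velocity and c^2 at the exit, f2(x) factors as
    (R - x) (a x / (g-1) + u^2 (R + x) / 2), and rho_sharp = R a / K. *)
Lemma f2_at_sharp r :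
  r0 <= r -> r <= r1 ->
  exists c, 0 < c /\
    f2 g r0 r1 I (exit_pressure r) (rho_sharp g I (exit_pressure r))
    = c * (critical_csq g B - behind_csq r r1).
Proof.
  intros Hr Hr1.
  destruct (behind_state r r1 Hr Hr1) as [S _].
  assert (HE := state_energy_pos _ _ _ _ _ _ hg S).
  assert (Hk : k1 = r1 * (rho (behind r) r1 * U1 (behind r) r1)).
  { destruct S as [_ [_ [_ [-> _]]]]; field; lra. }
  assert (HB : 0 < B).
  { unfold radial_energy in HE.
    assert (0 <= k2 ^ 2 / (2 * r1 ^ 2)); [|lra].
    apply Rmult_le_pos; [nra|]. apply Rlt_le, Rinv_0_lt_compat; nra. }
  destruct S as [HA' [Hrh [Hu [Em HEn]]]].
  assert (C := csq_pos g (entropy_behind r) (rho (behind r) r1) hg HA').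
  assert (HP : exit_pressure r = rho (behind r) r1 * behind_csq r r1 / g).
  { apply pressure_csq; auto. }
  unfold f2. rewrite Hk, HP.
  replace (B - k2 ^ 2 / (2 * r1 ^ 2)) with (radial_energy B k2 r1) by reflexivity.
  rewrite <- HEn; fold (behind_csq r r1) in *.
  set (a := behind_csq r r1) in *; set (R := rho (behind r) r1) in *.
  set (u := U1 (behind r) r1) in *.
  set (X := rho_sharp g I (R * a / g)).
  assert (HK : 0 < critical_csq g B).
  { apply Rmult_lt_0_compat; auto. apply Rdiv_lt_0_compat; lra. }
  assert (EX : X = R * a / critical_csq g B).
  { unfold X, rho_sharp, critical_csq; field; lra. }
  assert (HX : 0 < X) by (rewrite EX; apply Rdiv_lt_0_compat; nra).
  exists (R / critical_csq g B * (a / (g - 1) * X + u ^ 2 / 2 * (R + X))).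
  split.
  - apply Rmult_lt_0_compat; [now apply Rdiv_lt_0_compat|].
    assert (0 < a / (g - 1)) by (apply Rdiv_lt_0_compat; lra).
    assert (0 < a / (g - 1) * X) by (apply Rmult_lt_0_compat; auto).
    assert (0 < u ^ 2 / 2 * (R + X)); [|lra]. apply Rmult_lt_0_compat; nra.
  - replace (R / critical_csq g B * (a / (g - 1) * X + u ^ 2 / 2 * (R + X))
             * (critical_csq g B - a))
      with ((R - X) * (a / (g - 1) * X + u ^ 2 / 2 * (R + X)))
      by (rewrite EX at 1; field; split; lra).
    clearbody X; field; split; lra.
Qed.

Lemma ivp_solution_upto_closure (a : R) (b : Rbar) (F : flow) (x y : R) :
  ivp_solution g r0 I a b F -> a < x -> Rbar_lt y b -> solution_upto_closure g x y F.
Proof.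
  intros [Ha [_ [[S1 [S2 [S3 [S4 S5]]]] _]]] Hx Hy.
  assert (Hin : forall r, x <= r <= y -> a < r /\ Rbar_lt r b).
  { intros r Hr; split; [lra|]. exact (Rbar_le_lt_trans r y b (proj2 Hr) Hy). }
  assert (HS : forall f, smooth_on (fun r => a < r /\ Rbar_lt r b) f ->
     smooth_on (fun r => x < r < y) f /\ continuous_on (fun r => x <= r <= y) f).
  { intros f Hf; split.
    - intros n r Hr; apply Hf, Hin; lra.
    - apply continuous_on_of_continuous; intros r Hr.
      apply (ex_derive_continuous (V := R_NormedModule)), (Hf 1%nat r), Hin, Hr. }
  destruct (HS _ S1), (HS _ S2), (HS _ S3), (HS _ S4).
  assert (Hin' : forall r, x < r < y -> a < r /\ Rbar_lt r b) by (intros; apply Hin; lra).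
  split; [|split; [auto|split; [auto|split; [auto|split; [auto|]]]]].
  - split; [auto|split; [auto|split; [auto|split; [auto|]]]]. auto.
  - intros r Hr; destruct (S5 r (Hin r Hr)) as [? [? _]]; auto.
Qed.

(** A solution through the inflow data lies on the supersonic branch throughout
    its interval, including radii below r0: at a radius with M = 1 the level
    would be sonic, and at smaller radii of the open interval it would exceed the
    maximum of [mach_fn]. *)
Lemma r_star'_characterization s :
  is_r_star' g r0 I s ->
  admissible g k1 k2 B a0 s /\ shock_fn g k2 B s (ahead_mach s) = 1.
Proof.
  intros [a [b [F [[HF _] [Has [Hsb [_ Hf1]]]]]]].
  assert (HD : has_data r0 I F) by apply HF.
  destruct (proj1 HF) as [Ha0 Har].
  set (m := Rmin s r0); set (M := Rmax s r0).
  assert (Hm : a < m) by (apply Rmin_case; auto).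
  assert (HMb : Rbar_lt M b).
  { unfold M; apply Rmax_case; auto. apply HF. }
  assert (Hms : m <= s <= M) by (split; [apply Rmin_l | apply Rmax_l]).
  assert (Hmr : m <= r0 <= M) by (split; [apply Rmin_r | apply Rmax_r]).
  (* The invariants are propagated down to x; strict decrease of the level then
     keeps it below the sonic value on [y, M], since y > x. *)
  set (x := (a + m) / 2); set (y := (x + m) / 2).
  assert (Hxy : a < x /\ x < y /\ y < m) by (unfold y, x; lra).
  assert (HI : forall t, x <= t <= M -> invariants g k1 k2 B a0 F t).
  { apply (solution_invariants g k1 k2 B a0 x M F r0); try lra.
    - apply Rgt_not_eq, k1_pos.
    - apply (ivp_solution_upto_closure a b); auto; lra.
    - now apply inflow_invariants. }
  assert (HE : forall t, x <= t <= M -> 0 < radial_energy B k2 t).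
  { intros t Ht; assert (Ht0 : 0 < t) by lra.
    exact (state_energy_pos _ _ _ _ _ _ hg
      (invariants_state _ _ _ _ _ _ _ hg hA k1_pos Ht0 (HI t Ht))). }
  assert (HL : forall t, y <= t <= M -> flow_level g k1 k2 B a0 t < mach_fn g 1).
  { intros t Ht; apply (Rlt_le_trans _ (flow_level g k1 k2 B a0 x)).
    - apply flow_level_decreasing; auto using k1_pos; try lra. apply HE; lra.
    - assert (Hx0 : 0 < x) by lra.
      destruct (invariants_mach _ _ _ _ _ F x hg hA k1_pos Hx0 (HI x ltac:(lra)))
        as [M0 <-].
      destruct (Req_dec (radial_mach g F x) 1) as [->|Hne]; [lra|].
      apply Rlt_le, mach_fn_lt_sonic; auto. }
  assert (HMs : 1 < radial_mach g F s).
  { assert (M0 := inflow_mach _ HD).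
    assert (0 < (radial_mach g F r0 - 1) * (radial_mach g F s - 1)); [|nra].
    apply (solution_stays_on_branch g k1 k2 B a0 y M); auto using k1_pos; try lra.
    - apply (ivp_solution_upto_closure a b); auto; lra.
    - intros t Ht; apply HI; lra. }
  assert (HIs := HI s ltac:(lra)).
  assert (Hadm : admissible g k1 k2 B a0 s).
  { split; [lra|split; [apply HE; lra | apply HL; lra]]. }
  split; auto.
  destruct (invariants_mach _ _ _ _ _ F s hg hA k1_pos (proj1 Hadm) HIs) as [M0 EM].
  assert (EA : ahead_mach s = radial_mach g F s).
  { destruct (proj1 hp _ (proj2 (proj2 Hadm))) as [P0 [P1 P2]].
    unfold ahead_mach; apply (mach_fn_inj g); auto; [|congruence].
    apply Rmult_lt_0_compat; lra. }
  rewrite EA, <- Hf1; unfold f1, shock_fn, radial_mach, machsq.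
  destruct HIs as [I1 [I2 [I3 [I4 I5]]]].
  rewrite sound_sq by (auto; rewrite I2; auto).
  replace (U2 F s) with (k2 / s) by (rewrite <- I4; field; lra).
  f_equal; f_equal; f_equal. unfold prandtl, radial_energy; field; lra.
Qed.

(** f1 equals 1 at s.  Beyond s it increases from this positive value; before s
    a value of at least 1 would be positive and hence increase to more than 1. *)
Lemma regime_at_shock s r :
  is_r_star' g r0 I s -> r0 <= r ->
  (r < s -> behind_csq r r < critical_csq g B)
  /\ (r = s -> behind_csq r r = critical_csq g B)
  /\ (s < r -> critical_csq g B < behind_csq r r).
Proof.
  intros Hs Hr; destruct (r_star'_characterization s Hs) as [As Es].
  assert (Ar := ahead_admissible r Hr).
  assert (Mr := ahead_mach_gt_1 _ Ar); assert (Ms := ahead_mach_gt_1 _ As).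
  assert (EQ := csq_at_shock r Hr).
  set (c := (g - 1) / (g + 1) * (prandtl g (radial_energy B k2 r) / ahead_mach r)) in *.
  assert (Hc : 0 < c).
  { apply Rmult_lt_0_compat; apply Rdiv_lt_0_compat; try lra.
    apply prandtl_pos; auto. apply Ar. }
  set (f := shock_fn g k2 B r (ahead_mach r)) in *.
  split; [|split]; intros H.
  - assert (f < 1); [|nra].
    destruct (Rlt_le_dec f 1) as [|L]; auto; exfalso.
    (* Otherwise f would be positive, and f1 would exceed 1 at s. *)
    assert (f < shock_fn g k2 B s (ahead_mach s)); [|lra].
    apply shock_fn_increasing; auto; try apply Ar; try lra.
    + apply ahead_mach_increasing; auto.
    + fold f; lra.
  - assert (f = 1) by (unfold f; now rewrite H). nra.
  - assert (1 < f); [|nra].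
    rewrite <- Es; apply shock_fn_increasing; auto; try apply As; try lra.
    now apply ahead_mach_increasing.
Qed.

Lemma ahead_supersonic r : r0 <= r -> supersonic g ahead r.
Proof.
  intros Hr; destruct (ahead_state r Hr) as [S EM].
  apply radially_supersonic_supersonic; auto; [apply S|].
  rewrite EM; now apply ahead_mach_gt_1, ahead_admissible.
Qed.

Lemma patterns_supersonic_shock r :
  r0 < r < r1 -> behind_csq r r < critical_csq g B ->
  let f := f2 g r0 r1 I (exit_pressure r) (rho_sharp g I (exit_pressure r)) in
  (f > 0 -> supersonic_supersonic_shock g r0 r ahead (behind r)
            /\ supersonic_flow g r r1 (behind r))
  /\ (f < 0 -> supersonic_supersonic_shock g r0 r ahead (behind r)
               /\ supersonic_to_subsonic_flow g r r1 (behind r))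
  /\ (f = 0 -> supersonic_supersonic_shock g r0 r ahead (behind r)
               /\ supersonic_flow_sonic_exit g r r1 (behind r)).
Proof.
  intros Hr HK f.
  destruct (f2_at_sharp r ltac:(lra) ltac:(lra)) as [c [Hc Ef]]; fold f in Ef.
  assert (Hinc : forall s t, r <= s -> s < t -> behind_csq r s < behind_csq r t).
  { intros s t; apply behind_csq_increasing; lra. }
  assert (HR : forall s, r <= s -> _) by exact (fun s => behind_regime r s ltac:(lra)).
  set (K := critical_csq g B) in *.
  assert (Hss : supersonic_supersonic_shock g r0 r ahead (behind r)).
  { split; [intros s Hs; apply ahead_supersonic; lra|].
    apply (HR r); lra. }
  assert (Hlt : forall t, r <= t -> behind_csq r t <= K ->
    forall s, r <= s < t -> supersonic g (behind r) s).
  { intros t Ht HtK s Hs; apply (HR s); [lra|].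
    generalize (Hinc s t); lra. }
  split; [|split]; intros Hf; split; auto.
  - assert (H1 : behind_csq r r1 < K) by nra.
    intros s Hs; destruct (Req_dec s r1) as [->|Hne]; [apply (HR r1); lra|].
    apply (Hlt r1); lra.
  - assert (H1 : K < behind_csq r r1) by nra.
    destruct (IVT_gen_consistent (fun s => behind_csq r (clamp r r1 s)) r r1 K)
      as [c' [_ E]].
    + intros x; apply continuous_clamp_comp; [lra|].
      apply continuous_on_of_continuous; intros y Hy.
      apply behind_csq_continuous; lra.
    + rewrite !clamp_id by lra; unfold Rmin, Rmax; repeat destruct Rle_dec; lra.
    + assert (C := clamp_in r r1 c' ltac:(lra)).
      set (t := clamp r r1 c') in *; exists t.
      assert (t <> r) by (intros E'; rewrite E' in E; lra).
      assert (t <> r1) by (intros E'; rewrite E' in E; lra).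
      split; [lra|split; [|split]].
      * apply Hlt; lra.
      * apply (HR t); lra.
      * intros s Hs; apply (HR s); [lra|]. generalize (Hinc t s); lra.
  - assert (H1 : behind_csq r r1 = K) by nra.
    split; [apply Hlt; lra | apply (HR r1); lra].
Qed.

(** The squared speed is y + n (K - y) where y = c^2 and n = (g+1)/(g-1).  Its
    quotient by y decreases in y, so that its largest value, at the shock, bounds
    the quotient along the whole flow behind. *)
Lemma patterns_subsonic_shock r :
  r0 < r < r1 -> critical_csq g B < behind_csq r r ->
  supersonic_subsonic_shock g r0 r ahead (behind r)
  /\ subsonic_flow g r r1 (behind r) /\ uniformly_subsonic_flow g r r1 (behind r).
Proof.
  intros Hr HK; assert (Hr0 : r0 <= r) by lra.
  set (K := critical_csq g B) in *.
  assert (Hge : forall s, r <= s -> behind_csq r r <= behind_csq r s).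
  { intros s [Hs| ->]; [|lra]. apply Rlt_le, behind_csq_increasing; lra. }
  assert (Hsub : subsonic_flow g r r1 (behind r)).
  { intros s Hs; apply (behind_regime r s); [lra | lra |].
    specialize (Hge s ltac:(lra)); fold K; lra. }
  split; [|split; auto].
  - split; [intros s Hs; apply ahead_supersonic; lra | apply Hsub; lra].
  - assert (HB0 : 0 < behind_csq r r)
      by (apply csq_pos, entropy_behind_pos; auto).
    assert (Hn : 0 < (g + 1) / (g - 1)) by (apply Rdiv_lt_0_compat; lra).
    exists ((g + 1) / (g - 1) * (behind_csq r r - K) / behind_csq r r); split.
    + apply Rdiv_lt_0_compat; auto. apply Rmult_lt_0_compat; lra.
    + intros s Hs; destruct (behind_invariants r s Hr0 ltac:(lra)) as [I1 [I2 [_ [_ I5]]]].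
      assert (HA' : 0 < A (behind r) s) by (rewrite I2; now apply entropy_behind_pos).
      assert (E := speed_excess g B (behind r) s hg I1 HA' I5).
      assert (Ec := sound_sq g (behind r) s hg I1 HA').
      rewrite I2 in E, Ec; fold (behind_csq r s) in E, Ec; fold K in E.
      specialize (Hge s ltac:(lra)); rewrite Ec in *.
      set (n := (g + 1) / (g - 1)) in *.
      set (x := behind_csq r r) in *; set (y := behind_csq r s) in *.
      assert (HKp : 0 <= K).
      { assert (0 <= U1 (behind r) s ^ 2 + U2 (behind r) s ^ 2) by nra.
        destruct (behind_state r s Hr0 ltac:(lra)) as [S _].
        assert (HE := state_energy_pos _ _ _ _ _ _ hg S).
        unfold radial_energy in HE.
        assert (0 <= k2 ^ 2 / (2 * s ^ 2)).
        { apply Rmult_le_pos; [nra|]. apply Rlt_le, Rinv_0_lt_compat; nra. }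
        unfold K, critical_csq; apply Rmult_le_pos; [|lra].
        apply Rlt_le, Rdiv_lt_0_compat; lra. }
      assert (n * (K * (y - x) / x) >= 0).
      { apply Rle_ge, Rmult_le_pos; [lra|]. apply Rmult_le_pos; [nra|].
        apply Rlt_le, Rinv_0_lt_compat; lra. }
      replace ((1 - n * (x - K) / x) * y) with (y + n * (K - y) + n * (K * (y - x) / x))
        by (field; lra).
      lra.
Qed.

Lemma patterns_sonic_shock r :
  r0 < r < r1 -> behind_csq r r = critical_csq g B ->
  supersonic_sonic_shock g r0 r ahead (behind r)
  /\ subsonic_flow_sonic_shock g r r1 (behind r).
Proof.
  intros Hr HK; assert (Hr0 : r0 <= r) by lra.
  assert (Hson : sonic g (behind r) r) by (apply (behind_regime r r); auto; lra).
  split; split; auto.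
  - intros s Hs; apply ahead_supersonic; lra.
  - intros s Hs; apply (behind_regime r s); [lra | lra |].
    rewrite <- HK; apply behind_csq_increasing; lra.
Qed.

End RadialShock.

Theorem theorem3p1 (g r0 r1 : R) (I : inflow)
  (hg : 1 < g) (hr0 : 0 < r0) (hr1 : r0 < r1)
  (hrho : 0 < rho0 I) (hA : 0 < A0 I) (hU1 : 0 < U10 I) (hU2 : U20 I <> 0)
  (hsup : U10 I ^ 2 > g * A0 I * Rpower (rho0 I) (g - 1)) :
  exists (p1 p0 : R) (rb : R -> R) (Fm Fp : R -> flow),
    p1 < p0
    /\ (forall pex, p1 < pex < p0 ->
          shock_solution g r0 r1 I pex (rb pex) (Fm pex) (Fp pex)
          /\ (forall (s : R) (Gm Gp : flow),
                shock_solution g r0 r1 I pex s Gm Gp ->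
                s = rb pex
                /\ flow_eq_on r0 (rb pex) Gm (Fm pex)
                /\ flow_eq_on (rb pex) r1 Gp (Fp pex)))
    (* (A) *)
    /\ (forall pex pex', p1 < pex -> pex < pex' -> pex' < p0 ->
          rb pex' < rb pex)
    /\ filterlim rb (at_right p1) (locally r1)
    /\ filterlim rb (at_left p0) (locally r0)
    (* (B) *)
    /\ (forall rs' : R, is_r_star' g r0 I rs' ->
         (* r1 <= r'_* *)
         (r1 <= rs' -> forall pex, p1 < pex < p0 ->
            (f2 g r0 r1 I pex (rho_sharp g I pex) > 0 ->
               supersonic_supersonic_shock g r0 (rb pex) (Fm pex) (Fp pex)
               /\ supersonic_flow g (rb pex) r1 (Fp pex))
            /\ (f2 g r0 r1 I pex (rho_sharp g I pex) < 0 ->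
               supersonic_supersonic_shock g r0 (rb pex) (Fm pex) (Fp pex)
               /\ supersonic_to_subsonic_flow g (rb pex) r1 (Fp pex))
            /\ (f2 g r0 r1 I pex (rho_sharp g I pex) = 0 ->
               supersonic_supersonic_shock g r0 (rb pex) (Fm pex) (Fp pex)
               /\ supersonic_flow_sonic_exit g (rb pex) r1 (Fp pex)))
         (* r0 < r'_* < r1 *)
         /\ (r0 < rs' < r1 -> exists ps' : R, p1 < ps' < p0
            /\ (forall pex, ps' < pex < p0 ->
                  (f2 g r0 r1 I pex (rho_sharp g I pex) > 0 ->
                     supersonic_supersonic_shock g r0 (rb pex) (Fm pex) (Fp pex)
                     /\ supersonic_flow g (rb pex) r1 (Fp pex))
                  /\ (f2 g r0 r1 I pex (rho_sharp g I pex) < 0 ->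
                     supersonic_supersonic_shock g r0 (rb pex) (Fm pex) (Fp pex)
                     /\ supersonic_to_subsonic_flow g (rb pex) r1 (Fp pex))
                  /\ (f2 g r0 r1 I pex (rho_sharp g I pex) = 0 ->
                     supersonic_supersonic_shock g r0 (rb pex) (Fm pex) (Fp pex)
                     /\ supersonic_flow_sonic_exit g (rb pex) r1 (Fp pex)))
            /\ (forall pex, p1 < pex < ps' ->
                  supersonic_subsonic_shock g r0 (rb pex) (Fm pex) (Fp pex)
                  /\ subsonic_flow g (rb pex) r1 (Fp pex))
            /\ (supersonic_sonic_shock g r0 (rb ps') (Fm ps') (Fp ps')
                /\ subsonic_flow_sonic_shock g (rb ps') r1 (Fp ps')))
         (* r'_* <= r0 *)
         /\ (rs' <= r0 -> forall pex, p1 < pex < p0 ->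
               supersonic_subsonic_shock g r0 (rb pex) (Fm pex) (Fp pex)
               /\ uniformly_subsonic_flow g (rb pex) r1 (Fp pex))).
Proof.
  destruct (supersonic_branch_exists g hg) as [bp hp].
  destruct (subsonic_branch_exists g hg) as [bs hs].
  set (P := exit_pressure g r0 r1 I bp bs).
  assert (Pdec : forall x y, r0 <= x -> x < y -> y <= r1 -> P y < P x)
    by (intros x y; apply exit_pressure_decreasing; auto).
  destruct (decreasing_inverse P r0 r1) as [rb [Hrb [Hmono [Hlim1 Hlim0]]]]; auto.
  { intros x Hx; apply exit_pressure_continuous; auto. }
  exists (P r1), (P r0), rb, (fun _ => ahead g r0 I bp),
    (fun p => behind g r0 I bp bs (rb p)).
  assert (Hinj : forall x y, r0 <= x <= r1 -> r0 <= y <= r1 -> P x = P y -> x = y).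
  { intros x y Hx Hy E; destruct (Rtotal_order x y) as [H|[H|H]]; auto.
    - generalize (Pdec x y); lra.
    - generalize (Pdec y x); lra. }
  split; [apply Pdec; lra|].
  split; [|split; [exact Hmono|split; [exact Hlim1|split; [exact Hlim0|]]]].
  - intros pex Hp; destruct (Hrb pex Hp) as [H1 H2]; split.
    + rewrite <- H2 at 1; apply shock_solution_exists; auto.
    + intros s Gm Gp HG.
      destruct (shock_solution_unique g r0 r1 I bp bs hg hr0 hrho hA hU1 hsup hp hs
        pex s Gm Gp HG) as [Hs [Es [Em Ep]]].
      assert (s = rb pex) as -> by (apply Hinj; [lra | lra |]; fold P in Es; congruence).
      auto.
  - intros s Hs.
    assert (Hreg := fun r : R => regime_at_shock g r0 I bp bs hg hr0 hrho hA hU1 hsup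
      hp hs s r Hs).
    assert (Hsup := fun r : R => patterns_supersonic_shock g r0 r1 I bp bs hg hr0 hrho hA
      hU1 hsup hp hs r).
    assert (Hsub := fun r : R => patterns_subsonic_shock g r0 r1 I bp bs hg hr0 hrho hA
      hU1 hsup hp hs r).
    fold P in Hsup.
    split; [|split].
    + intros Hs1 pex Hp; destruct (Hrb pex Hp) as [H1 H2].
      specialize (Hsup (rb pex) H1); cbv zeta in Hsup; rewrite H2 in Hsup; apply Hsup.
      apply Hreg; lra.
    + intros Hs1.
      assert (Hq0 : P r1 < P s < P r0) by (split; apply Pdec; lra).
      assert (Hq : rb (P s) = s).
      { destruct (Hrb (P s) Hq0); apply Hinj; lra. }
      exists (P s); split; [exact Hq0|split; [|split]].
      * intros pex Hp; destruct (Hrb pex) as [H1 H2]; [lra|].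
        assert (rb pex < s) by (rewrite <- Hq; apply Hmono; lra).
        specialize (Hsup (rb pex) H1); cbv zeta in Hsup; rewrite H2 in Hsup; apply Hsup.
        apply Hreg; lra.
      * intros pex Hp; destruct (Hrb pex) as [H1 H2]; [lra|].
        assert (s < rb pex) by (rewrite <- Hq; apply Hmono; lra).
        destruct (Hsub (rb pex) H1) as [S1 [S2 _]]; [apply Hreg; lra | auto].
      * rewrite Hq.
        apply (patterns_sonic_shock g r0 r1 I bp bs); auto. apply Hreg; lra.
    + intros Hs1 pex Hp; destruct (Hrb pex Hp) as [H1 H2].
      destruct (Hsub (rb pex) H1) as [S1 [_ S2]]; [apply Hreg; lra | auto].
Qed.
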